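(* Define integers $C_{1^{2}2^{2}3^{-1}}(n)$ by \[ \frac{(q;q)_\infty^{2}\,(q^2;q^2)_\infty^{2}}{(q^3;q^3)_\infty}=\sum_{n\geq 0}C_{1^{2}2^{2}3^{-1}}(n)\,q^n . \] For $n\in\mathbb N_0$, write $8n+1=3^a m$ with $a\in\mathbb N_0$ and $3\nmid m$. Then \[ \operatorname{sgn}\left(C_{1^{2}2^{2}3^{-1}}(n)\right)=\begin{cases}\left(\frac{m}{3}\right)&\text{if } a=0,\\[2pt] -\frac{\left(\frac{m}{3}\right)+1}{2}&\text{if } a=1,\\[2pt] -1&\text{if } a=2,\\[2pt] \operatorname{sgn}\left(C_{1^{2}2^{2}3^{-1}}\left(\frac{n-1}{9}\right)\right)&\text{if } a\geq 3.\end{cases} \]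
   Context: $(a;q)_\infty:=\prod_{j\geq 0}(1-aq^j)$ denotes the $q$-Pochhammer symbol; $\left(\frac{\cdot}{3}\right)$ is the Legendre symbol. (When $a\ge3$, $n\equiv 1\pmod 9$, so $\frac{n-1}{9}\in\mathbb N_0$ and $8\cdot\frac{n-1}{9}+1=\frac{8n+1}{9}$.) *)

(* Defs.v *)
From mathcomp Require Import all_boot all_order all_algebra.
Set Implicit Arguments. Unset Strict Implicit. Unset Printing Implicit Defensive.
Import Order.TTheory GRing.Theory Num.Theory.
Local Open Scope ring_scope.

(* Truncated geometric series sum_{k=0}^{N} X^(d k), i.e. 1/(1 - X^d) modulo X^(N+1)
   (for d >= 1). *)
Definition geom_trunc (d N : nat) : {poly int} :=
  \sum_(k < N.+1) 'X^(d * k).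

(* Truncation (to order N) of
   (q;q)^2 (q^2;q^2)^2 / (q^3;q^3) = prod_{j>=1} (1-q^j)^2 (1-q^(2j))^2 / (1-q^(3j)).
   Factors with j > N are = 1 modulo q^(N+1), and 1/(1-q^(3j)) is replaced by its
   truncated geometric series; hence coefficients of q^n with n <= N are exact. *)
Definition eta_trunc (N : nat) : {poly int} :=
  \prod_(j < N) ((1 - 'X^(j.+1)) ^+ 2 * (1 - 'X^(2 * j.+1)) ^+ 2
                 * geom_trunc (3 * j.+1) N).

Definition C122 (n : nat) : int := (eta_trunc n.+1)`_n.

Definition legendre3 (m : nat) : int :=
  if (m %% 3 == 1)%N then 1 else if (m %% 3 == 2)%N then -1 else 0.

(* Main.v *)
(* The eta quotient is [f = psi(q) b(q)], with [psi = sum_k q^(k(k+1)/2)] and Borwein's cubic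
   theta function [b = (q;q)^3 / (q^3;q^3)].  The 3-dissections have the form [psi(q) = u (1 + w)]
   and [phi(-q) = s (1 - 2 w)] with a common [w], and dissect [f] explicitly: the part of [f] at
   exponents 0 (resp. 2) mod 3 is that of [psi(q) a(q)] times 1 (resp. -1/2), and
     [sum_k C(3k+1) q^k = -2 psi(q^3) a(q^2)].
   Since [a(q) = a(q^3) + 2 c(q^3)], dissecting further gives [C(9j+4) = 0],
   [C(9j+7) = -4 [q^(3j+2)] psi^3] and [C(9j+1) = -2 [q^j] psi(q) a(q^2)]; the last number is
   [C(j)] when [j = 1] mod 3 and [-2 [q^j] psi(q) a(q)] otherwise.  With [A] the function in
   [psi(q) = A(q^3) + q psi(q^9)],
     [psi(q) a(q) = A^3 + 4 q psi(q^3)^3]  and  [[q^(3n)] psi^3 = [q^n] (A^3 + q psi(q^3)^3)],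
   so all signs follow from Gauss' theorem that [psi^3] has positive coefficients.  This one
   is read off Andrews' formula, proved by a Bailey-type argument,
     [psi^3 = sum_n (1 + q^(2n+1)) / (1 - q^(2n+1)) sum_(j <= 2n) q^(2n^2 + 2n - j(j+1)/2)]. *)
Require Import Defs.
From HB Require Import structures.
From mathcomp Require Import all_boot all_order all_algebra.
From mathcomp Require Import boolp.
From mathcomp Require Import zify ring.
Import Order.TTheory GRing.Theory Num.Theory.
Local Open Scope ring_scope.

(** * Formal power series *)

Record fps := Fps { coef :> nat -> int }.

HB.instance Definition _ := gen_eqMixin fps.
HB.instance Definition _ := gen_choiceMixin fps.

Lemma fpsP (f g : fps) : (forall n, f n = g n) -> f = g.
Proof. by case: f g => [f] [g] /= h; congr Fps; apply: funext. Qed.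

Definition fps0 := Fps (fun=> 0).
Definition fps1 := Fps (fun n => (n == 0%N)%:R).
Definition fpsD (f g : fps) := Fps (fun n => f n + g n).
Definition fpsN (f : fps) := Fps (fun n => - f n).
Definition fpsM (f g : fps) := Fps (fun n => \sum_(i < n.+1) f i * g (n - i)%N).

(** Ring laws for series are inherited from [{poly int}]: a coefficient of index at most [N] in a
    product depends only on the truncations at [N]. *)
Definition trunc (N : nat) (f : fps) : {poly int} := \poly_(i < N.+1) f i.

Lemma coef_trunc N f i : (i <= N)%N -> (trunc N f)`_i = f i.
Proof. by rewrite coef_poly ltnS => ->. Qed.

Lemma fpsM_trunc N (f g : fps) n : (n <= N)%N ->
  fpsM f g n = (trunc N f * trunc N g)`_n.
Proof.
move=> nN; rewrite coefM /=; apply: eq_bigr => i _.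
by rewrite !coef_trunc // ?(leq_trans (leq_subr _ _)) // (leq_trans _ nN) // -ltnS.
Qed.

Fact fpsDA : associative fpsD.
Proof. by move=> f g h; apply: fpsP => n /=; rewrite addrA. Qed.
Fact fpsDC : commutative fpsD.
Proof. by move=> f g; apply: fpsP => n /=; rewrite addrC. Qed.
Fact fps0D : left_id fps0 fpsD.
Proof. by move=> f; apply: fpsP => n /=; rewrite add0r. Qed.
Fact fpsND : left_inverse fps0 fpsN fpsD.
Proof. by move=> f; apply: fpsP => n /=; rewrite addNr. Qed.

HB.instance Definition _ := GRing.isZmodule.Build fps fpsDA fpsDC fps0D fpsND.

Fact fpsMC : commutative fpsM.
Proof. by move=> f g; apply: fpsP => n; rewrite !(fpsM_trunc n) // mulrC. Qed.

Fact fpsMA : associative fpsM.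
Proof.
move=> f g h; apply: fpsP => n.
transitivity ((trunc n f * (trunc n g * trunc n h))`_n).
  rewrite coefM /=; apply: eq_bigr => i _.
  have ni : (i <= n)%N by rewrite -ltnS.
  by rewrite coef_trunc // -[\sum_(_ < _) _]/(fpsM g h _) (fpsM_trunc n) // leq_subr.
rewrite mulrA coefM /=; apply: eq_bigr => i _.
have ni : (i <= n)%N by rewrite -ltnS.
by rewrite (@coef_trunc _ h) ?leq_subr // -[\sum_(_ < _) _]/(fpsM f g _) (fpsM_trunc n).
Qed.

Fact fps1M : left_id fps1 fpsM.
Proof.
move=> f; apply: fpsP => n /=; rewrite big_ord_recl /= mul1r subn0 big1 ?addr0 //.
by move=> i _; rewrite mul0r.
Qed.

Fact fpsMDl : left_distributive fpsM fpsD.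
Proof.
move=> f g h; apply: fpsP => n /=; rewrite -big_split /=.
by apply: eq_bigr => i _; rewrite mulrDl.
Qed.

Fact fps1_neq0 : fps1 != fps0.
Proof. by apply/eqP => /(congr1 (coef^~ 0%N)). Qed.

HB.instance Definition _ :=
  GRing.Zmodule_isComNzRing.Build fps fpsMA fpsMC fps1M fpsMDl fps1_neq0.

Lemma coef0E n : (0 : fps) n = 0. Proof. by []. Qed.
Lemma coef1E n : (1 : fps) n = (n == 0%N)%:R. Proof. by []. Qed.
Lemma coefDE (f g : fps) n : (f + g) n = f n + g n. Proof. by []. Qed.
Lemma coefNE (f : fps) n : (- f) n = - f n. Proof. by []. Qed.
Lemma coefBE (f g : fps) n : (f - g) n = f n - g n. Proof. by []. Qed.
Lemma coefME (f g : fps) n : (f * g) n = \sum_(i < n.+1) f i * g (n - i)%N.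
Proof. by []. Qed.

Lemma coef_sumE I (r : seq I) (Q : pred I) (F : I -> fps) n :
  (\sum_(i <- r | Q i) F i) n = \sum_(i <- r | Q i) F i n.
Proof. by elim/big_rec2: _ => // i y x _ <-. Qed.

Lemma coefMnE (f : fps) m n : (f *+ m) n = f n *+ m.
Proof. by elim: m => // m IH; rewrite !mulrS coefDE IH. Qed.

Lemma coefM0 (f g : fps) : (f * g) 0%N = f 0%N * g 0%N.
Proof. by rewrite coefME big_ord_recl big_ord0 addr0. Qed.

Definition X : fps := Fps (fun n => (n == 1%N)%:R).

Lemma fcoefXnM m (f : fps) n :
  (X ^+ m * f) n = if (m <= n)%N then f (n - m)%N else 0.
Proof.
elim: m n => [|m IH] n; first by rewrite mul1r subn0.
rewrite exprS -mulrA coefME big_ord_recl /= mul0r add0r.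
case: n => [|n]; first by rewrite big_ord0.
rewrite big_ord_recl /= mul1r [X in _ + X]big1 ?addr0; last first.
  by move=> i _; rewrite mul0r.
by rewrite -[LHS]/((X ^+ m * f) (n.+1 - 1)%N) subn1 IH ltnS subSS.
Qed.

Lemma fcoefXM (f : fps) n : (X * f) n.+1 = f n.
Proof. by rewrite -[X]expr1 fcoefXnM subn1. Qed.

Lemma fcoefXn m n : (X ^+ m) n = (n == m)%:R.
Proof.
by rewrite -[X ^+ m]mulr1 fcoefXnM coef1E subn_eq0 eqn_leq; case: leqP; rewrite ?andbT ?andbF.
Qed.

(** * Congruence modulo [X ^+ n], infinite sums and infinite products *)

Definition eqm (n : nat) (f g : fps) := forall i, (i < n)%N -> f i = g i.

Lemma eqmP f g : (forall n, eqm n f g) -> f = g.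
Proof. by move=> h; apply: fpsP => n; apply: (h n.+1). Qed.

Lemma eqm_refl n f : eqm n f f. Proof. by []. Qed.
#[local] Hint Resolve eqm_refl : core.

Lemma eqm_sym n f g : eqm n f g -> eqm n g f.
Proof. by move=> h i /h. Qed.

Lemma eqm_trans n g f h : eqm n f g -> eqm n g h -> eqm n f h.
Proof. by move=> h1 h2 i li; rewrite h1 ?h2. Qed.

Lemma eqm_le m n f g : (m <= n)%N -> eqm n f g -> eqm m f g.
Proof. by move=> mn h i im; apply: h; apply: leq_trans mn. Qed.

Lemma eqmD n f f' g g' : eqm n f f' -> eqm n g g' -> eqm n (f + g) (f' + g').
Proof. by move=> h1 h2 i li; rewrite !coefDE h1 ?h2. Qed.

Lemma eqmN n f f' : eqm n f f' -> eqm n (- f) (- f').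
Proof. by move=> h1 i li; rewrite !coefNE h1. Qed.

Lemma eqmM n f f' g g' : eqm n f f' -> eqm n g g' -> eqm n (f * g) (f' * g').
Proof.
move=> h1 h2 i li; rewrite !coefME; apply: eq_bigr => -[j /= lj] _.
by rewrite h1 ?h2 //; lia.
Qed.

Lemma eqmX n f f' k : eqm n f f' -> eqm n (f ^+ k) (f' ^+ k).
Proof. by move=> h; elim: k => // k IH; rewrite !exprS; apply: eqmM. Qed.

Lemma eqm_sum n I (r : seq I) (Q : pred I) (F G : I -> fps) :
  (forall i, Q i -> eqm n (F i) (G i)) ->
  eqm n (\sum_(i <- r | Q i) F i) (\sum_(i <- r | Q i) G i).
Proof. by move=> h; elim/big_rec2: _ => // i x y Qi; apply: eqmD; apply: h. Qed.

Lemma eqm_prod n I (r : seq I) (Q : pred I) (F G : I -> fps) :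
  (forall i, Q i -> eqm n (F i) (G i)) ->
  eqm n (\prod_(i <- r | Q i) F i) (\prod_(i <- r | Q i) G i).
Proof. by move=> h; elim/big_rec2: _ => // i x y Qi; apply: eqmM; apply: h. Qed.

Lemma eqmXn0 n m (f : fps) : (n <= m)%N -> eqm n (X ^+ m * f) 0.
Proof. by move=> nm i li; rewrite fcoefXnM leqNgt (leq_trans li nm). Qed.

Lemma eqmXnM n m (f g : fps) : eqm n f g -> eqm (m + n) (X ^+ m * f) (X ^+ m * g).
Proof. by move=> h i li; rewrite !fcoefXnM; case: leqP => // mi; apply: h; lia. Qed.

Lemma eqmM00 n m (f g : fps) : eqm n f 0 -> eqm m g 0 -> eqm (n + m) (f * g) 0.
Proof.
move=> hf hg i li; rewrite coefME big1 // => -[j /= lj] _.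
have [jn|nj] := ltnP j n; first by rewrite hf // mul0r.
by rewrite hg ?mulr0 //; lia.
Qed.

(** No limit is taken: coefficient [n] is read from the first [n.+1] terms or factors. This is the
    right value when term [i] is 0 (resp. factor [i] is 1) modulo [X ^+ i], which is what [summable]
    and [multipliable] ask. *)
Definition isum (F : nat -> fps) : fps := Fps (fun n => \sum_(i < n.+1) F i n).
Definition iprod (F : nat -> fps) : fps := Fps (fun n => (\prod_(i < n.+1) F i) n).
Definition summable (F : nat -> fps) := forall i, eqm i (F i) 0.
Definition multipliable (F : nat -> fps) := forall i, eqm i (F i) 1.

Lemma isum_eqm F n m : summable F -> (n <= m)%N -> eqm n (isum F) (\sum_(i < m) F i).
Proof.
move=> hF nm i li /=; rewrite coef_sumE.
rewrite (big_ord_widen m (fun j => F j i)); last by lia.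
rewrite big_mkcond /=; apply: eq_bigr => j _.
by case: ltnP => // ij; rewrite hF.
Qed.

Lemma iprod_eqm F n m : multipliable F -> (n <= m)%N -> eqm n (iprod F) (\prod_(i < m) F i).
Proof.
move=> hF nm i li /=.
have {nm} im : (i.+1 <= m)%N by apply: leq_trans nm.
rewrite -(subnKC im); elim: (m - i.+1)%N => [|k IH]; first by rewrite addn0.
rewrite addnS [in RHS]big_ord_recr /= {}IH.
have h : eqm i.+1 (\prod_(i0 < i.+1 + k) F i0)
   ((\prod_(i0 < i.+1 + k) F i0) * F (i.+1 + k)%N).
  rewrite -[X in eqm _ X _]mulr1; apply: eqmM => //; apply: eqm_sym.
  by apply: eqm_le (hF _); lia.
by apply: h.
Qed.

Lemma eq_isum F G : F =1 G -> isum F = isum G.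
Proof. by move=> h; apply: fpsP => n /=; apply: eq_bigr => i _; rewrite h. Qed.

Lemma eq_iprod F G : F =1 G -> iprod F = iprod G.
Proof.
by move=> h; apply: fpsP => n /=; congr (coef _ n); apply: eq_bigr => i _; rewrite h.
Qed.

Lemma isumP F g : summable F -> (forall n, exists2 m, (n <= m)%N & eqm n (\sum_(i < m) F i) g) ->
  isum F = g.
Proof.
move=> hF h; apply: eqmP => n; have [m nm hm] := h n.
exact: eqm_trans (isum_eqm _ _ _ hF nm) hm.
Qed.

Lemma iprodP F g : multipliable F ->
  (forall n, exists2 m, (n <= m)%N & eqm n (\prod_(i < m) F i) g) -> iprod F = g.
Proof.
move=> hF h; apply: eqmP => n; have [m nm hm] := h n.
exact: eqm_trans (iprod_eqm _ _ _ hF nm) hm.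
Qed.

Lemma summableXn e (F : nat -> fps) : (forall i, (i <= e i)%N) ->
  summable (fun i => X ^+ e i * F i).
Proof. by move=> h i; apply: eqmXn0. Qed.

Lemma summableM g F : summable F -> summable (fun i => g * F i).
Proof. by move=> hF i; rewrite -(mulr0 g); apply: eqmM. Qed.

Lemma summableD F G : summable F -> summable G -> summable (fun i => F i + G i).
Proof. by move=> hF hG i; rewrite -(addr0 0); apply: eqmD. Qed.

Lemma summable_comp F h : (forall i, (i <= h i)%N) -> summable F -> summable (fun i => F (h i)).
Proof. by move=> hh hF i; apply: eqm_le (hF _). Qed.

Lemma multipliableM F G :
  multipliable F -> multipliable G -> multipliable (fun i => F i * G i).
Proof. by move=> hF hG i; rewrite -(mulr1 1); apply: eqmM. Qed.

Lemma multipliable_comp F h :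
  (forall i, (i <= h i)%N) -> multipliable F -> multipliable (fun i => F (h i)).
Proof. by move=> hh hF i; apply: eqm_le (hF _). Qed.

Lemma isumM g F : summable F -> isum (fun i => g * F i) = g * isum F.
Proof.
move=> hF; apply: isumP => [|n]; first exact: summableM.
exists n => //; rewrite -mulr_sumr; apply: eqmM => //.
by apply: eqm_sym; apply: isum_eqm.
Qed.

Lemma isumD F G : isum (fun i => F i + G i) = isum F + isum G.
Proof. by apply: fpsP => n /=; rewrite -big_split. Qed.

Lemma isum_recl F : summable F -> isum F = F 0%N + isum (fun i => F i.+1).
Proof.
move=> hF; apply: isumP => // n; exists n.+1 => //; rewrite big_ord_recl.
apply: eqmD => //; apply: eqm_sym; apply: (isum_eqm (fun i => F i.+1)) => //.
by apply: summable_comp.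
Qed.

Lemma iprod_recl F : multipliable F -> iprod F = F 0%N * iprod (fun i => F i.+1).
Proof.
move=> hF; apply: iprodP => // n; exists n.+1 => //; rewrite big_ord_recl.
apply: eqmM => //; apply: eqm_sym; apply: (iprod_eqm (fun i => F i.+1)) => //.
by apply: multipliable_comp.
Qed.

Lemma iprodM F G : multipliable F -> multipliable G ->
  iprod (fun i => F i * G i) = iprod F * iprod G.
Proof.
move=> hF hG; apply: iprodP => [|n]; first exact: multipliableM.
exists n => //; rewrite big_split /=.
by apply: eqmM; apply: eqm_sym; apply: iprod_eqm.
Qed.

Lemma isum_split3 F : summable F ->
  isum F = isum (fun i => F (3 * i)%N) + isum (fun i => F (3 * i).+1)
           + isum (fun i => F (3 * i).+2).
Proof.
move=> hF; apply: isumP => // n; exists (3 * n)%N; first by lia.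
rewrite -!isumD; apply: eqm_sym.
pose G i := F (3 * i)%N + F (3 * i).+1 + F (3 * i).+2.
have hG : summable G.
  by do 2?apply: summableD; apply: summable_comp hF => i; lia.
apply: eqm_trans (isum_eqm _ n n hG _) _ => //.
suff -> : \sum_(i < n) G i = \sum_(i < 3 * n) F i by [].
elim: n => [|n IH]; first by rewrite muln0 !big_ord0.
by rewrite mulnS addnC !addnS addn0 !big_ord_recr /= IH /G !addrA.
Qed.

Lemma iprod_split2 F : multipliable F ->
  iprod F = iprod (fun i => F (2 * i)%N) * iprod (fun i => F (2 * i).+1).
Proof.
move=> hF; apply: iprodP => // n; exists (2 * n)%N; first by lia.
rewrite -iprodM; do ?[by apply: multipliable_comp hF => i; lia].
apply: eqm_sym.
pose G i := F (2 * i)%N * F (2 * i).+1.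
have hG : multipliable G.
  by apply: multipliableM; apply: multipliable_comp hF => i; lia.
apply: eqm_trans (iprod_eqm _ n n hG _) _ => //.
suff -> : \prod_(i < n) G i = \prod_(i < 2 * n) F i by [].
elim: n => [|n IH]; first by rewrite muln0 !big_ord0.
by rewrite mulnS addnC !addnS addn0 !big_ord_recr /= IH /G !mulrA.
Qed.

Lemma iprod_split3 F : multipliable F ->
  iprod F = iprod (fun i => F (3 * i)%N) * iprod (fun i => F (3 * i).+1)
            * iprod (fun i => F (3 * i).+2).
Proof.
move=> hF; apply: iprodP => // n; exists (3 * n)%N; first by lia.
rewrite -!iprodM; do ?[by do ?apply: multipliableM; apply: multipliable_comp hF => i; lia].
apply: eqm_sym.
pose G i := F (3 * i)%N * F (3 * i).+1 * F (3 * i).+2.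
have hG : multipliable G.
  by do 2?apply: multipliableM; apply: multipliable_comp hF => i; lia.
apply: eqm_trans (iprod_eqm _ n n hG _) _ => //.
suff -> : \prod_(i < n) G i = \prod_(i < 3 * n) F i by [].
elim: n => [|n IH]; first by rewrite muln0 !big_ord0.
by rewrite mulnS addnC !addnS addn0 !big_ord_recr /= IH /G !mulrA.
Qed.

(** * Units and inverses of power series *)

Definition fps_unit : pred fps := fun f => f 0%N \is a GRing.unit.

(** A unit constant term [c] is 1 or -1, hence its own inverse, and the geometric series in
    [1 - c * f] inverts [c * f]. Non-units are fixed, as the unit ring interface demands. *)
Definition fps_inv (f : fps) : fps :=
  if fps_unit f then (f 0%N)%:~R * isum (fun i => (1 - (f 0%N)%:~R * f) ^+ i) else f.

Lemma coef_intr0 (c : int) : (c%:~R : fps) 0%N = c.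
Proof.
by case: c => n; rewrite ?NegzE ?mulrNz ?coefNE -pmulrn coefMnE coef1E eqxx -[true%:R]/1 natz.
Qed.

Lemma summable_exp (g : fps) : g 0%N = 0 -> summable (fun i => g ^+ i).
Proof.
move=> g0; elim=> [|i IH] //; rewrite exprS -add1n; apply: eqmM00 => //.
by case.
Qed.

Lemma isum_exp (g : fps) : g 0%N = 0 -> (1 - g) * isum (fun i => g ^+ i) = 1.
Proof.
move=> g0; have hs := summable_exp _ g0.
rewrite mulrBl mul1r -(isumM _ _ hs) {1}(isum_recl _ hs) expr0.
by under eq_isum => i do rewrite exprS; rewrite addrK.
Qed.

Fact fps_mulVf : {in fps_unit, left_inverse 1 fps_inv *%R}.
Proof.
move=> f uf; have {}uf : fps_unit f by []. rewrite /fps_inv uf; set c : fps := _%:~R.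
rewrite mulrAC -[X in X * _ = _](subKr 1) isum_exp // coefBE coefM0 coef_intr0.
by move: uf; rewrite /fps_unit => /orP[] /eqP ->; rewrite coef1E.
Qed.

Fact fps_unitP (x y : fps) : y * x = 1 -> fps_unit x.
Proof.
move=> /(congr1 (coef^~ 0%N)); rewrite coefM0 coef1E eqxx => h.
by apply/unitrPr; exists (y 0%N); rewrite mulrC.
Qed.

Fact fps_inv_out : {in [predC fps_unit], fps_inv =1 id}.
Proof. by move=> f nf; rewrite /fps_inv ifN. Qed.

HB.instance Definition _ :=
  GRing.ComNzRing_hasMulInverse.Build fps fps_mulVf fps_unitP fps_inv_out.

Lemma unit_fps (f : fps) : f 0%N = 1 -> f \is a GRing.unit.
Proof. by move=> f0; rewrite unfold_in /= /fps_unit f0 unitr1. Qed.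

Lemma fpsM1 (f g : fps) : f 0%N = 1 -> g 0%N = 1 -> (f * g) 0%N = 1.
Proof. by move=> h1 h2; rewrite coefM0 h1 h2 mulr1. Qed.

Lemma fps_prod1 n (F : nat -> fps) :
  (forall i, F i 0%N = 1) -> (\prod_(i < n) F i) 0%N = 1.
Proof. by move=> h; elim/big_ind: _ => // x y; apply: fpsM1. Qed.

Lemma fps_iprod1 (F : nat -> fps) : (forall i, F i 0%N = 1) -> (iprod F) 0%N = 1.
Proof. by move=> h; apply: fps_prod1. Qed.

Lemma eqmV n (f g : fps) : f 0%N = 1 -> g 0%N = 1 -> eqm n f g -> eqm n f^-1 g^-1.
Proof.
move=> f0 g0 h.
have uf := unit_fps _ f0; have ug := unit_fps _ g0.
have -> : f^-1 = f^-1 * g^-1 * g by rewrite mulrVK.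
rewrite [X in eqm _ _ X](_ : _ = f^-1 * g^-1 * f); last by rewrite mulrAC mulVr // mul1r.
by apply: eqmM => //; apply: eqm_sym.
Qed.

(* [f(q^k)]; a ring morphism only for [k > 0], hence the instances on [sub k.+1]. *)
Definition sub (k : nat) (f : fps) : fps :=
  Fps (fun n => if (k %| n)%N then f (n %/ k)%N else 0).

(** On truncations [sub] is composition with a power of the variable, from which multiplicativity is
    inherited. *)
Lemma sub_trunc k N (f : fps) n : (n <= N)%N ->
  sub k.+1 f n = (trunc N f \Po 'X^(k.+1))`_n.
Proof.
move=> nN; rewrite coef_comp_poly_Xn //=; case: ifP => // _.
by rewrite coef_trunc // (leq_trans (leq_div _ _)).
Qed.

Fact subB k : zmod_morphism (sub k.+1).
Proof.
by move=> f g; apply: fpsP => n; rewrite coefBE /=; case: ifP => //; rewrite subr0.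
Qed.

Fact subM k : monoid_morphism (sub k.+1).
Proof.
split=> [|f g]; apply: fpsP => n.
  rewrite /=; case: ifP => [/dvdnP[m ->]|]; first by rewrite mulnK // muln_eq0 orbF.
  by case: n.
transitivity ((trunc n f * trunc n g \Po 'X^(k.+1))`_n).
  rewrite coef_comp_poly_Xn //=; case: ifP => // _.
  by apply: fpsM_trunc; rewrite leq_div.
rewrite comp_polyM coefM coefME; apply: eq_bigr => -[i /= li] _.
by rewrite -!(sub_trunc _ n) //; lia.
Qed.

HB.instance Definition _ k := GRing.isZmodMorphism.Build fps fps (sub k.+1) (subB k).
HB.instance Definition _ k := GRing.isMonoidMorphism.Build fps fps (sub k.+1) (subM k).

Lemma sub_X k : sub k.+1 X = X ^+ k.+1.
Proof.
apply: fpsP => n; rewrite fcoefXn /=; case: ifP => [/dvdnP[m ->]|].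
  by rewrite mulnK // -{2}[k.+1]mul1n eqn_pmul2r.
by case: eqVneq => // ->; rewrite dvdnn.
Qed.

Lemma sub_Xn k n : sub k.+1 (X ^+ n) = X ^+ (k.+1 * n).
Proof. by rewrite rmorphXn /= sub_X exprM. Qed.

Lemma subK j k f : sub j.+1 (sub k.+1 f) = sub (j.+1 * k.+1) f.
Proof.
apply: fpsP => n /=; case: (boolP (j.+1 %| n)%N) => [/dvdnP[m ->]|nj].
  by rewrite mulnK // [(m * _)%N]mulnC dvdn_pmul2l // divnMl.
by rewrite ifN //; apply: contra nj => /(dvdn_trans _) -> //; rewrite dvdn_mulr.
Qed.

Lemma eqm_sub k n f g : eqm n f g -> eqm n (sub k.+1 f) (sub k.+1 g).
Proof. by move=> h i li /=; case: ifP => // _; apply: h; rewrite (leq_ltn_trans (leq_div _ _)). Qed.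

Lemma summable_sub k F : summable F -> summable (fun i => sub k.+1 (F i)).
Proof. by move=> hF i; rewrite -(rmorph0 (sub k.+1)); apply: eqm_sub. Qed.

Lemma multipliable_sub k F : multipliable F -> multipliable (fun i => sub k.+1 (F i)).
Proof. by move=> hF i; rewrite -(rmorph1 (sub k.+1)); apply: eqm_sub. Qed.

Lemma sub_isum k F : summable F -> sub k.+1 (isum F) = isum (fun i => sub k.+1 (F i)).
Proof.
move=> hF; symmetry; apply: isumP => [|n]; first exact: summable_sub.
exists n => //; rewrite -rmorph_sum /=; apply: eqm_sub.
by apply: eqm_sym; apply: isum_eqm.
Qed.

Lemma sub_iprod k F : multipliable F -> sub k.+1 (iprod F) = iprod (fun i => sub k.+1 (F i)).
Proof.
move=> hF; symmetry; apply: iprodP => [|n]; first exact: multipliable_sub.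
exists n => //; rewrite -rmorph_prod /=; apply: eqm_sub.
by apply: eqm_sym; apply: iprod_eqm.
Qed.

Lemma sub0 k (f : fps) : sub k f 0%N = f 0%N.
Proof. by rewrite /= dvdn0 div0n. Qed.

(** * The Jacobi triple product *)

Definition qfact (q : fps) (n : nat) : fps := \prod_(j < n) (1 - q ^+ j.+1).

Lemma qfactS (q : fps) n : qfact q n.+1 = qfact q n * (1 - q ^+ n.+1).
Proof. by rewrite /qfact big_ord_recr. Qed.

Lemma qfact_1 (q : fps) n : q 0%N = 0 -> qfact q n 0%N = 1.
Proof.
move=> q0; apply: (fps_prod1 n (fun j => 1 - q ^+ j.+1)) => i.
by rewrite coefBE exprS coefM0 q0 mul0r subr0.
Qed.

Lemma qfact_unit (q : fps) n : q 0%N = 0 -> qfact q n \is a GRing.unit.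
Proof. by move=> q0; apply/unit_fps/qfact_1. Qed.

Lemma qfactV (q : fps) n : q 0%N = 0 -> (1 - q ^+ n.+1) * (qfact q n.+1)^-1 = (qfact q n)^-1.
Proof.
move=> q0; rewrite qfactS; apply: (mulrI (qfact_unit _ n q0)).
rewrite mulrA divrr ?divrr ?qfact_unit // -qfactS; exact: qfact_unit.
Qed.

(** This is [sum_i [n, i]_q t_i] divided by [(q;q)_n], with Gaussian binomials [[n, i]_q], which
    thus need no definition of their own. *)
Definition qconv (q : fps) (n : nat) (t : nat -> fps) : fps :=
  \sum_(i < n.+1) (qfact q i)^-1 * (qfact q (n - i))^-1 * t i.

Lemma eq_qconv (q : fps) n t t' :
  (forall i, (i <= n)%N -> t i = t' i) -> qconv q n t = qconv q n t'.
Proof. by move=> h; apply: eq_bigr => -[i /= li] _; rewrite h. Qed.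

Lemma qconvZ (q : fps) n c t : qconv q n (fun i => c * t i) = c * qconv q n t.
Proof. by rewrite /qconv mulr_sumr; apply: eq_bigr => i _; rewrite mulrCA. Qed.

Lemma qconvD (q : fps) n t t' : qconv q n (fun i => t i + t' i) = qconv q n t + qconv q n t'.
Proof. by rewrite /qconv -big_split; apply: eq_bigr => i _; rewrite mulrDr. Qed.

Lemma qconv_low (q : fps) n t : q 0%N = 0 ->
  qconv q n.+1 (fun i => (1 - q ^+ i) * t i) = qconv q n (fun i => t i.+1).
Proof.
move=> q0; rewrite /qconv big_ord_recl /= expr0 subrr mul0r mulr0 add0r.
apply: eq_bigr => i _; rewrite /bump /= add1n subSS -(qfactV q i) //; ring.
Qed.

Lemma qconv_high (q : fps) n t : q 0%N = 0 ->
  qconv q n.+1 (fun i => (1 - q ^+ (n.+1 - i)) * t i) = qconv q n t.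
Proof.
move=> q0; rewrite /qconv big_ord_recr /= subnn expr0 subrr mul0r mulr0 addr0.
by apply: eq_bigr => -[i /= li] _; rewrite subSn // -(qfactV q (n - i)) //; ring.
Qed.

(** A q-Pascal rule, from [1 - q^(n+1) = (1 - q^i) + q^i (1 - q^(n+1-i))]; [qconvS_high] is the
    other one, with [i] and [n + 1 - i] exchanged. *)
Lemma qconvS_low (q : fps) n t : q 0%N = 0 ->
  (1 - q ^+ n.+1) * qconv q n.+1 t =
  qconv q n (fun i => t i.+1) + qconv q n (fun i => q ^+ i * t i).
Proof.
move=> q0; rewrite -(qconv_low q n t) // -(qconv_high q n (fun i => q ^+ i * t i)) //.
rewrite -qconvD -qconvZ.
apply: eq_qconv => i li; rewrite -{1}(subnK li) exprD; ring.
Qed.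

Lemma qconvS_high (q : fps) n t : q 0%N = 0 ->
  (1 - q ^+ n.+1) * qconv q n.+1 t =
  qconv q n t + qconv q n (fun i => q ^+ (n - i) * t i.+1).
Proof.
move=> q0; rewrite -(qconv_low q n (fun i => q ^+ (n.+1 - i) * t i)) // -(qconv_high q n t) //.
rewrite -qconvD -qconvZ; apply: eq_qconv => i li; rewrite -{1}(subnK li) exprD; ring.
Qed.

(** The summand [z^k q^(k(k-1)/2)] of the triple product, for [q = z p] and [k = i - N]; the second
    form avoids negative powers when [k < 0]. *)
Definition theta_term (z p : fps) (i N : nat) : fps :=
  if (N <= i)%N then z ^+ (i - N) * (z * p) ^+ 'C(i - N, 2)
  else p ^+ (N - i) * (z * p) ^+ 'C(N - i, 2).

Lemma theta_term_shift z p i N :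
  (z * p) ^+ i * theta_term z p i N.+1 = p * (z * p) ^+ N * theta_term z p i N.
Proof.
rewrite /theta_term; case: (ltngtP N i) => [Ni|iN|->].
- have -> : (i - N = (i - N.+1).+1)%N by lia.
  have {1}-> : (i = (i - N.+1) + N + 1)%N by lia.
  rewrite binS bin1 !exprD !exprS; ring.
- have -> : (N.+1 - i = (N - i).+1)%N by lia.
  rewrite binS bin1 exprS !exprD.
  have {4}-> : (N = (N - i) + i)%N by lia.
  rewrite !exprD; ring.
- by rewrite subSnn subnn !expr0 expr1 !mulr1 mulrC.
Qed.

Lemma divr_cancel4 (R : comUnitRingType) (u x y v : R) :
  u \is a GRing.unit -> u * (x * y * (u^-1 * v)) = x * v * y.
Proof. by move=> hu; rewrite mulrCA [u * _]mulrA divrr // mul1r mulrAC. Qed.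

(** A finite triple product: adding a factor in [z] amounts to [qconvS_high], adding one in [p] to
    [qconvS_low] together with [theta_term_shift]. *)
Lemma jacobi_triple_fin (z p : fps) M N : (z * p) 0%N = 0 ->
  (\prod_(j < M) (1 + z * (z * p) ^+ j)) * (\prod_(j < N) (1 + p * (z * p) ^+ j))
    * (qfact (z * p) (M + N))^-1 =
  qconv (z * p) (M + N) (fun i => theta_term z p i N).
Proof.
move=> q0.
have vS n : (qfact (z * p) n.+1)^-1 = (1 - (z * p) ^+ n.+1)^-1 * (qfact (z * p) n)^-1.
  by rewrite qfactS invrM ?qfact_unit // unit_fps // coefBE exprS coefM0 q0 mul0r subr0.
have u n : 1 - (z * p) ^+ n.+1 \is a GRing.unit.
  by apply: unit_fps; rewrite coefBE exprS coefM0 q0 mul0r subr0.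
elim: N => [|N IH].
  rewrite big_ord0 mulr1 addn0; elim: M => [|M IH].
    by rewrite /qconv big_ord_recl !big_ord0 /theta_term /= subnn bin0n /qfact !big_ord0
      invr1 !mulr1 addr0.
  rewrite big_ord_recr /= vS; apply: (mulrI (u M)); rewrite qconvS_high //.
  rewrite divr_cancel4 // IH mulrDr mulr1; congr (_ + _).
  rewrite mulrC -qconvZ; apply: eq_qconv => i li; rewrite /theta_term !subn0 /= binS bin1.
  by rewrite exprD exprS -{1}(subnK li) exprD; ring.
rewrite big_ord_recr /= addnS vS; apply: (mulrI (u (M + N)%N)); rewrite qconvS_low //.
rewrite mulrA divr_cancel4 // IH mulrDr mulr1; congr (_ + _).
by rewrite mulrC -qconvZ; apply: eq_qconv => i _; rewrite theta_term_shift.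
Qed.

Lemma qfact_eqm (q : fps) n m : q 0%N = 0 ->
  (n <= m)%N -> eqm n.+1 (qfact q m) (iprod (fun j => 1 - q ^+ j.+1)).
Proof.
move=> q0 nm.
have hm : multipliable (fun j => 1 - q ^+ j.+1).
  move=> i; rewrite -[X in eqm _ _ X]subr0; apply: eqmD => //; apply: eqmN.
  exact: eqm_le (summable_exp _ q0 i.+1).
have h : eqm m (1 - q ^+ m.+1) 1 by apply: hm.
apply: eqm_trans (eqm_sym _ _ _ (iprod_eqm _ n.+1 m.+1 hm _)) => //.
(* Precision [n.+1] calls for [m.+1] factors of the infinite product; the last one, [1 - q ^+ m.+1],
   is 1 at this precision. *)
rewrite [X in eqm _ _ X]big_ord_recr /= -[X in eqm _ X _]mulr1; apply: eqmM => //.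
apply: eqm_sym; rewrite -[X in eqm _ _ X]subr0; apply: eqmD => //; apply: eqmN.
exact: eqm_le (summable_exp _ q0 m.+1).
Qed.

(* [sum_(k in Z) e^k q^(a k + (a + b) k (k - 1) / 2)], where [e = 1] or [e = -1]. *)
Definition theta (e : fps) (a b : nat) : fps :=
  isum (fun k => e ^+ k * X ^+ (a * k + (a + b) * 'C(k, 2)))
  + isum (fun k => e ^+ k.+1 * X ^+ (b * k.+1 + (a + b) * 'C(k.+1, 2))).

Lemma bin2_ge d : (d.-1 <= 'C(d, 2))%N.
Proof. by case: d => // d; rewrite binS bin1 /= leq_addl. Qed.

Lemma summable_theta1 e a b : (0 < a)%N ->
  summable (fun k => e ^+ k * X ^+ (a * k + (a + b) * 'C(k, 2))).
Proof. by move=> a0 k; rewrite mulrC; apply: eqmXn0; nia. Qed.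

Lemma summable_theta2 e a b : (0 < a)%N ->
  summable (fun k => e ^+ k.+1 * X ^+ (b * k.+1 + (a + b) * 'C(k.+1, 2))).
Proof. by move=> a0 k; rewrite mulrC; apply: eqmXn0; have := bin2_ge k.+1; nia. Qed.

Lemma multipliable_1DXn e (f : nat -> nat) : (forall i, (i <= f i)%N) ->
  multipliable (fun j => 1 + e * X ^+ f j).
Proof.
move=> hf i; rewrite -[X in eqm _ _ X]addr0; apply: eqmD => //.
by rewrite mulrC; apply: eqmXn0.
Qed.

Lemma multipliable_1BXn (f : nat -> nat) : (forall i, (i <= f i)%N) ->
  multipliable (fun j => 1 - X ^+ f j).
Proof.
move=> hf i; rewrite -[X in eqm _ _ X]subr0; apply: eqmD => //; apply: eqmN.
by rewrite -[X ^+ _]mulr1; apply: eqmXn0.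
Qed.

(** The limit of [jacobi_triple_fin] for [M = N = n], at [z = e q^a] and [p = e q^b]; since
    [e^2 = 1], the base is [z p = q^(a+b)]. The case [b = 0] is included and serves for [psi]. *)
Theorem jacobi_triple (e : fps) (a b : nat) : e * e = 1 -> (0 < a)%N ->
  theta e a b = iprod (fun j => 1 + e * X ^+ (a + (a + b) * j))
              * iprod (fun j => 1 + e * X ^+ (b + (a + b) * j))
              * iprod (fun j => 1 - X ^+ ((a + b) * j.+1)).
Proof.
move=> ee a0.
set F1 := iprod _; set F2 := iprod _; set E := iprod _.
pose z := e * X ^+ a; pose p := e * X ^+ b.
have zp : z * p = X ^+ (a + b) by rewrite /z /p mulrACA ee mul1r exprD.
have q0 : (z * p) 0%N = 0 by rewrite zp fcoefXn; case: (a) a0.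
have E1 : E 0%N = 1.
  by apply: fps_iprod1 => i; rewrite coefBE coef1E fcoefXn; case: (a) a0.
have uE : E \is a GRing.unit by apply: unit_fps.
have hE n m : (n <= m)%N -> eqm n.+1 (qfact (z * p) m)^-1 E^-1.
  move=> nm; apply: eqmV => //; first exact: qfact_1.
  apply: eqm_trans (qfact_eqm _ _ _ q0 nm) _ => //.
  by rewrite zp (eq_iprod _ (fun j => 1 - X ^+ ((a + b) * j.+1))) // => j; rewrite exprM.
suff h : F1 * F2 * E^-1 = E^-1 * E^-1 * theta e a b.
  have uV : E^-1 \is a GRing.unit by rewrite unitrV.
  apply: (mulrI uV); rewrite [RHS]mulrC mulrK //.
  by apply: (mulrI uV); rewrite mulrA -h mulrC.
apply: eqmP => n.
have hL : eqm n (F1 * F2 * E^-1)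
  ((\prod_(j < n) (1 + z * (z * p) ^+ j)) * (\prod_(j < n) (1 + p * (z * p) ^+ j))
    * (qfact (z * p) (n + n))^-1).
  apply: eqmM; last by apply: eqm_sym; apply: eqm_le (hE n _ _); lia.
  apply: eqmM.
  - apply: eqm_trans (iprod_eqm _ n n _ _) _ => //.
      by apply: multipliable_1DXn => i; nia.
    by apply: eqm_prod => i _; rewrite zp /z -exprM -mulrA -exprD.
  - apply: eqm_trans (iprod_eqm _ n n _ _) _ => //.
      by apply: multipliable_1DXn => i; nia.
    by apply: eqm_prod => i _; rewrite zp /p -exprM -mulrA -exprD.
apply: eqm_trans hL _; rewrite jacobi_triple_fin // /qconv.
have -> : ((n + n).+1 = n + n.+1)%N by rewrite addnS.
rewrite big_split_ord /= (reindex_inj rev_ord_inj) /= /theta mulrDr [X in eqm _ X _]addrC.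
(* A term divisible by [X ^+ d] needs its inverse q-factorials only modulo [X ^+ (n - d)], which
   their lengths allow. *)
have key d u u' (t : fps) : (d <= n)%N -> eqm (n - d) u u' ->
    eqm n (u * (X ^+ d * t)) (u' * (X ^+ d * t)).
  move=> dn hu; rewrite !(mulrCA _ (X ^+ d)).
  apply: (eqm_le n (d + (n - d))); first by rewrite subnKC.
  by apply: eqmXnM; apply: eqmM.
apply: eqmD.
  apply: eqm_sym; apply: eqm_trans (eqmM _ _ _ _ _ (eqm_refl _ _)
    (isum_eqm _ n n.+1 (summable_theta1 e a b a0) _)) _ => //.
  rewrite mulr_sumr; apply: eqm_sum => -[d /= ld] _.
  rewrite /theta_term leq_addr addKn zp /z exprMn -!exprM -[_ * X ^+ _ * X ^+ _]mulrA -exprD.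
  have -> : (a * d + (a + b) * 'C(d, 2) = d + (a * d - d + (a + b) * 'C(d, 2)))%N by nia.
  rewrite exprD [e ^+ d * _]mulrCA; apply: key; first by lia.
  rewrite -zp; apply: eqmM; apply: eqm_sym; first by apply: eqm_le (hE n _ _); lia.
  by apply: eqm_le (hE (n - d)%N _ _); lia.
apply: eqm_sym; apply: eqm_trans (eqmM _ _ _ _ _ (eqm_refl _ _)
    (isum_eqm _ n n (summable_theta2 e a b a0) _)) _ => //.
rewrite mulr_sumr; apply: eqm_sum => -[d /= ld] _.
rewrite /theta_term ifN; last by lia.
have -> : (n - (n - d.+1) = d.+1)%N by lia.
rewrite zp /p exprMn -!exprM -[_ * X ^+ _ * X ^+ _]mulrA -exprD.
have -> : (b * d.+1 + (a + b) * 'C(d.+1, 2)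
    = d + (b * d.+1 + (a + b) * 'C(d.+1, 2) - d))%N by have := bin2_ge d.+1; nia.
rewrite exprD [e ^+ d.+1 * _]mulrCA; apply: key; first by lia.
rewrite -zp; apply: eqmM; apply: eqm_sym; first by apply: eqm_le (hE (n - d.+1)%N _ _); lia.
by apply: eqm_le (hE n _ _); lia.
Qed.

(** * Theta functions and their 3-dissections *)

(* [Ek] is [(q^k; q^k)], [O1] is [(q; q^2)] and [D1] is [(-q; q)]. *)
Definition E1 : fps := iprod (fun j => 1 - X ^+ j.+1).
Definition E2 : fps := sub 2 E1.
Definition E3 : fps := sub 3 E1.
Definition E6 : fps := sub 6 E1.
Definition O1 : fps := iprod (fun j => 1 - X ^+ (2 * j).+1).
Definition D1 : fps := iprod (fun j => 1 + X ^+ j.+1).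

(* Ramanujan's theta functions: [psi] is [psi(q)], [phi] is [phi(-q)] (with a minus sign),
   and [A3], [W3] are the functions in the 3-dissections of [psi] and [phi]. *)
Definition psi : fps := isum (fun k => X ^+ 'C(k.+1, 2)).
Definition psi3 : fps := sub 3 psi.
Definition A3 : fps := theta 1 2 1.
Definition phi : fps := theta (-1) 1 1.
Definition phi3 : fps := sub 3 phi.
Definition W3 : fps := theta (-1) 5 1.

Lemma sub3E2 : sub 3 E2 = E6. Proof. exact: (subK 2 1). Qed.
Lemma sub2E3 : sub 2 E3 = E6. Proof. exact: (subK 1 2). Qed.

Lemma sub_1BXn k n : sub k.+1 (1 - X ^+ n) = 1 - X ^+ (k.+1 * n).
Proof. by rewrite rmorphB rmorph1 /= sub_Xn. Qed.

Lemma sub_1DXn k n : sub k.+1 (1 + X ^+ n) = 1 + X ^+ (k.+1 * n).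
Proof. by rewrite rmorphD rmorph1 /= sub_Xn. Qed.

Lemma multipliable_1DX (f : nat -> nat) : (forall i, (i <= f i)%N) ->
  multipliable (fun j => 1 + X ^+ f j).
Proof. by move=> hf i; have := multipliable_1DXn 1 f hf i; rewrite mul1r. Qed.

Lemma sub_E1 k : sub k.+1 E1 = iprod (fun j => 1 - X ^+ (k.+1 * j.+1)).
Proof.
rewrite sub_iprod; last by apply: multipliable_1BXn.
by apply: eq_iprod => i; rewrite sub_1BXn.
Qed.

Lemma sub_O1 k : sub k.+1 O1 = iprod (fun j => 1 - X ^+ (k.+1 * (2 * j).+1)).
Proof.
rewrite sub_iprod; last by apply: multipliable_1BXn => i; lia.
by apply: eq_iprod => i; rewrite sub_1BXn.
Qed.

Lemma E1_O1 : E1 = O1 * E2.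
Proof.
rewrite /E1 iprod_split2; last by apply: multipliable_1BXn => i; lia.
congr (_ * _); rewrite /E2 sub_E1; apply: eq_iprod => i; congr (1 - X ^+ _); lia.
Qed.

Lemma E2_D1 : D1 * E1 = E2.
Proof.
rewrite /D1 /E1 -iprodM; last 2 first.
- by apply: multipliable_1DX => i; lia.
- by apply: multipliable_1BXn => i; lia.
rewrite /E2 sub_E1; apply: eq_iprod => i.
by rewrite mulrC -subr_sqr expr1n -exprM mulnC.
Qed.

Lemma E3_O1 : E3 = sub 3 O1 * E6.
Proof. by rewrite -sub3E2 -rmorphM -E1_O1. Qed.

Lemma E6_D1 : sub 3 D1 * E3 = E6.
Proof. by rewrite -sub3E2 -rmorphM E2_D1. Qed.

Lemma E1_const : E1 0%N = 1.
Proof. by apply: fps_iprod1 => i; rewrite coefBE coef1E fcoefXn subr0. Qed.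

Lemma E1_unit : E1 \is a GRing.unit. Proof. exact: unit_fps E1_const. Qed.
Lemma E2_unit : E2 \is a GRing.unit. Proof. by apply: unit_fps; rewrite sub0 E1_const. Qed.
Lemma E3_unit : E3 \is a GRing.unit. Proof. by apply: unit_fps; rewrite sub0 E1_const. Qed.
Lemma E6_unit : E6 \is a GRing.unit. Proof. by apply: unit_fps; rewrite sub0 E1_const. Qed.

Lemma summable_psi : summable (fun k => X ^+ 'C(k.+1, 2)).
Proof. by move=> i; rewrite -[X ^+ _]mulr1; apply: eqmXn0; exact: (bin2_ge i.+1). Qed.

(** Each half of [theta 1 1 0] runs once over the triangular numbers. *)
Lemma psi_theta : theta 1 1 0 = psi + psi.
Proof.
rewrite /theta; congr (_ + _); apply: eq_isum => k; rewrite expr1n mul1r; congr (X ^+ _).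
  by rewrite binS bin1; lia.
by lia.
Qed.

Lemma psi_E : psi * E1 = E2 ^+ 2.
Proof.
suff h : psi = D1 * D1 * E1 by rewrite h -E2_D1; ring.
(* The triple product only gives twice the claim: its factor [1 + X ^+ 0 = 2] is split off, and 2 is
   cancelled coefficientwise. *)
have : psi + psi = D1 * D1 * E1 + D1 * D1 * E1.
  rewrite -psi_theta jacobi_triple ?mulr1 //.
  have -> : iprod (fun j => 1 + 1 * X ^+ (1 + (1 + 0) * j)) = D1.
    by apply: eq_iprod => j; rewrite mul1r mul1n add1n.
  have -> : iprod (fun j => 1 - X ^+ ((1 + 0) * j.+1)) = E1.
    by apply: eq_iprod => j; rewrite mul1n.
  rewrite iprod_recl; last by apply: multipliable_1DXn => i; lia.
  have -> : iprod (fun j => 1 + 1 * X ^+ (0 + (1 + 0) * j.+1)) = D1.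
    by apply: eq_iprod => j; rewrite mul1r mul1n.
  by rewrite expr0; ring.
move=> h; apply: fpsP => n; move/(congr1 (coef^~ n)): h; rewrite !coefDE; lia.
Qed.

Lemma A3_E : A3 * E1 * E6 = E2 * E3 ^+ 2.
Proof.
suff h : A3 * sub 3 D1 = D1 * E3 by rewrite -E6_D1 -E2_D1; ring: h.
rewrite /A3 jacobi_triple ?mulr1 //.
rewrite [D1 in RHS]/D1 [iprod (fun j => 1 + X ^+ j.+1)]iprod_split3;
  last by apply: multipliable_1DX => i; lia.
rewrite /E3 sub_E1 /D1 sub_iprod; last by apply: multipliable_1DX => i; lia.
rewrite (eq_iprod (fun j => 1 + 1 * X ^+ (2 + (2 + 1) * j)) (fun i => 1 + X ^+ (3 * i).+2)).
  rewrite (eq_iprod (fun j => 1 + 1 * X ^+ (1 + (2 + 1) * j)) (fun i => 1 + X ^+ (3 * i).+1)).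
    rewrite (eq_iprod (fun i => sub 3 (1 + X ^+ i.+1)) (fun i => 1 + X ^+ (3 * i).+3)).
      by ring.
    by move=> i; rewrite sub_1DXn; congr (1 + X ^+ _); lia.
  by move=> i; rewrite mul1r; congr (1 + X ^+ _); lia.
by move=> i; rewrite mul1r; congr (1 + X ^+ _); lia.
Qed.

Lemma phi_E : phi * E2 = E1 ^+ 2.
Proof.
rewrite /phi jacobi_triple ?mulrNN ?mulr1 // E1_O1 [E2 in LHS]/E2 sub_E1.
have -> : iprod (fun j => 1 + -1 * X ^+ (1 + (1 + 1) * j)) = O1.
  by apply: eq_iprod => j; rewrite mulN1r.
rewrite -[iprod (fun j => 1 - X ^+ (2 * j.+1))]/(iprod (fun j => 1 - X ^+ ((1 + 1) * j.+1))).
by rewrite /E2 sub_E1; ring.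
Qed.

Lemma W3_E : W3 * E2 * E3 = E1 * E6 ^+ 2.
Proof.
suff h : W3 * sub 3 O1 = O1 * E6 by rewrite E3_O1 E1_O1; ring: h.
rewrite /W3 jacobi_triple ?mulrNN ?mulr1 //.
rewrite [O1 in RHS]/O1 [iprod (fun j => 1 - X ^+ (2 * j).+1)]iprod_split3;
  last by apply: multipliable_1BXn => i; lia.
rewrite /E6 sub_E1 sub_O1.
rewrite (eq_iprod (fun j => 1 + -1 * X ^+ (5 + (5 + 1) * j))
                  (fun i => 1 - X ^+ (2 * (3 * i).+2).+1)).
  rewrite (eq_iprod (fun j => 1 + -1 * X ^+ (1 + (5 + 1) * j))
                    (fun i => 1 - X ^+ (2 * (3 * i)).+1)).
    rewrite (eq_iprod (fun j => 1 - X ^+ (3 * (2 * j).+1))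
                      (fun i => 1 - X ^+ (2 * (3 * i).+1).+1)).
      rewrite -[iprod (fun j => 1 - X ^+ ((5 + 1) * j.+1))]/(iprod (fun j => 1 - X ^+ (6 * j.+1))).
      by ring.
    by move=> i; congr (1 - X ^+ _); lia.
  by move=> i; rewrite mulN1r; congr (1 - X ^+ _); lia.
by move=> i; rewrite mulN1r; congr (1 - X ^+ _); lia.
Qed.

Lemma bin2E n : ('C(n, 2) * 2 = n * n.-1)%N.
Proof. by rewrite -[2%N in LHS]/(2`!) bin_ffact ffactnS ffactn1. Qed.

Lemma sub_theta k e a b : sub k.+1 e = e -> (0 < a)%N ->
  sub k.+1 (theta e a b) =
    isum (fun i => e ^+ i * X ^+ (k.+1 * (a * i + (a + b) * 'C(i, 2))))
    + isum (fun i => e ^+ i.+1 * X ^+ (k.+1 * (b * i.+1 + (a + b) * 'C(i.+1, 2)))).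
Proof.
move=> he a0; rewrite /theta rmorphD /=.
rewrite !sub_isum; [|exact: summable_theta2|exact: summable_theta1].
by congr (_ + _); apply: eq_isum => i; rewrite rmorphM rmorphXn /= he sub_Xn.
Qed.

(** With [T(k) = k(k+1)/2], one has [T(3i+1) = 9 T(i) + 1], while [T(3i)] and [T(3i+2)] are
    multiples of 3 and give the two halves of [A3]. *)
Lemma psi_split3 : psi = sub 3 A3 + X * sub 3 psi3.
Proof.
rewrite [in LHS]/psi isum_split3; last exact: summable_psi.
rewrite addrAC /A3 sub_theta ?rmorph1 //; congr (_ + _ + _).
- apply: eq_isum => k; rewrite expr1n mul1r; congr (X ^+ _).
  by have := bin2E (3 * k).+1; have := bin2E k; nia.
- apply: eq_isum => k; rewrite expr1n mul1r; congr (X ^+ _).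
  by have := bin2E (3 * k).+3; have := bin2E k.+1; nia.
rewrite /psi3 subK /psi sub_isum; last exact: summable_psi.
rewrite -isumM; last by apply: summable_sub; exact: summable_psi.
apply: eq_isum => k; rewrite sub_Xn -exprS; congr (X ^+ _).
by have := bin2E (3 * k).+2; have := bin2E k.+1; nia.
Qed.

(** [phi] is the sum of [(-1)^k q^(k^2)] over the integers. Multiples of 3 give [phi3], and
    [(3i+1)^2 = 3(3i^2+2i) + 1] gives [W3], twice because of [k] and [-k]. *)
Lemma phi_split3 : phi = sub 3 phi3 - 2 * X * sub 3 W3.
Proof.
have h1 := summable_theta1 (-1) 1 1 isT; have h2 := summable_theta2 (-1) 1 1 isT.
have sN1 k : sub k.+1 (-1) = -1 by rewrite rmorphN rmorph1.
rewrite [in LHS]/phi /theta (isum_split3 _ h1) (isum_split3 _ h2).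
rewrite /phi3 subK -[(3 * 3)%N]/9%N /phi /W3 !sub_theta //.
(* Squares prime to 3 occur in both halves of [phi], so [a1] and [a2] each capture two sums and only
   [b2] is left. *)
set a0 := isum _; set a1 := isum _; set a2 := isum _.
set b2 := isum _.
set s0 := isum _; set s1 := isum _; set w0 := isum _; set w1 := isum _.
have sgn3 i : (-1) ^+ (3 * i) = (-1) ^+ i :> fps.
  by rewrite exprM; congr (_ ^+ _); ring.
have isumE (F G : nat -> fps) : summable G -> (forall i, F i = - X * G i) -> isum F = - X * isum G.
  by move=> hG h; rewrite (eq_isum _ _ h) isumM.
have hw0 : summable (fun k => (-1) ^+ k * X ^+ (3 * (5 * k + (5 + 1) * 'C(k, 2)))).
  by move=> k; rewrite mulrC; apply: eqmXn0; nia.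
have hw1 : summable (fun k => (-1) ^+ k.+1 * X ^+ (3 * (1 * k.+1 + (5 + 1) * 'C(k.+1, 2)))).
  by move=> k; rewrite mulrC; apply: eqmXn0; nia.
have -> : a0 = s0.
  apply: eq_isum => i; rewrite sgn3; congr (_ * X ^+ _).
  by have := bin2E (3 * i); have := bin2E i; nia.
have -> : b2 = s1.
  apply: eq_isum => i; rewrite -[(3 * i).+3]/(3 + 3 * i)%N -mulnS sgn3; congr (_ * X ^+ _).
  by have := bin2E (3 * i.+1); have := bin2E i.+1; nia.
have -> : a1 = - X * w0.
  apply: isumE => // i; rewrite exprS sgn3.
  rewrite (_ : (1 * _ + _)%N = (3 * (5 * i + (5 + 1) * 'C(i, 2))).+1).
    by rewrite [X ^+ _.+1]exprS; ring.
  by have := bin2E (3 * i).+1; have := bin2E i; nia.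
have -> : a2 = - X * w1.
  apply: isumE => // i; rewrite ![(-1) ^+ _.+1]exprS sgn3.
  rewrite (_ : (1 * (3 * i).+2 + _)%N = (3 * (1 * i.+1 + (5 + 1) * 'C(i.+1, 2))).+1).
    by rewrite [X ^+ _.+1]exprS; ring.
  by have := bin2E (3 * i).+2; have := bin2E i.+1; nia.
ring.
Qed.

Lemma psi3_E : psi3 * E3 = E6 ^+ 2.
Proof. by rewrite /psi3 /E3 -rmorphM psi_E rmorphXn /= sub3E2. Qed.

Lemma phi3_E : phi3 * E6 = E3 ^+ 2.
Proof. by rewrite /phi3 -sub3E2 -rmorphM phi_E rmorphXn. Qed.

Lemma A3_const : A3 0%N = 1.
Proof.
have := congr1 (coef^~ 0%N) A3_E.
by rewrite !coefM0 !sub0 E1_const !mulr1.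
Qed.

Lemma psi_const : psi 0%N = 1.
Proof. by rewrite /= big_ord1 fcoefXn. Qed.

Lemma A3_unit : A3 \is a GRing.unit. Proof. exact: unit_fps A3_const. Qed.
Lemma psi_unit : psi \is a GRing.unit. Proof. exact: unit_fps psi_const. Qed.
Lemma psi3_unit : psi3 \is a GRing.unit.
Proof. by apply: unit_fps; rewrite sub0 psi_const. Qed.

(** * Relations between the theta functions, by cancellation of eta factors *)

Lemma phi_psi : phi * psi = E1 * E2.
Proof.
apply: (mulIr E1_unit).
apply: (mulIr E2_unit).
have h : (phi * E2) * (psi * E1) = E1 ^+ 2 * E2 ^+ 2 by rewrite phi_E psi_E; ring.
by transitivity ((phi * E2) * (psi * E1)); [ring | rewrite h; ring].
Qed.

Lemma phi2_psi : phi ^+ 2 * psi = E1 ^+ 3.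
Proof.
apply: (mulIr E2_unit).
have h : (phi * psi) * (phi * E2) = E1 ^+ 3 * E2 by rewrite phi_psi phi_E; ring.
by transitivity ((phi * psi) * (phi * E2)); [ring | rewrite h; ring].
Qed.

Lemma phi_psi2 : phi * psi ^+ 2 = E2 ^+ 3.
Proof.
apply: (mulIr E1_unit).
have h : (phi * psi) * (psi * E1) = E1 * E2 ^+ 3 by rewrite phi_psi psi_E; ring.
by transitivity ((phi * psi) * (psi * E1)); [ring | rewrite h; ring].
Qed.

(** This expresses that the ratio [w] is the same in both 3-dissections: [psi3 / A3 = W3 / phi3]. *)
Lemma A3_W3 : A3 * W3 = phi3 * psi3.
Proof.
apply: (mulIr E1_unit).
apply: (mulIr E6_unit).
apply: (mulIr E2_unit).
apply: (mulIr E3_unit).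
have h : (A3 * E1 * E6) * (W3 * E2 * E3)
  = (phi3 * E6) * (psi3 * E3) * (E1 * E2).
  by rewrite A3_E W3_E phi3_E psi3_E; ring.
by transitivity ((A3 * E1 * E6) * (W3 * E2 * E3)); [ring | rewrite h; ring].
Qed.

Lemma phi3_E2 : phi3 * E2 = E1 * A3.
Proof.
apply: (mulIr E6_unit).
have h : (phi3 * E6) * E2 = A3 * E1 * E6 by rewrite phi3_E A3_E; ring.
by transitivity ((phi3 * E6) * E2); [ring | rewrite h; ring].
Qed.

Lemma psi_phi3 : psi * phi3 = E2 * A3.
Proof.
apply: (mulIr E1_unit).
have h : (psi * E1) * phi3 = E2 * (E1 * A3) by rewrite -phi3_E2 psi_E; ring.
by transitivity ((psi * E1) * phi3); [ring | rewrite h; ring].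
Qed.

Lemma W3_E2 : W3 * E2 = psi3 * E1.
Proof.
apply: (mulIr E3_unit).
have h : W3 * E2 * E3 = (psi3 * E3) * E1 by rewrite W3_E psi3_E; ring.
by transitivity (W3 * E2 * E3); [ring | rewrite h; ring].
Qed.

Lemma psi_W3 : psi * W3 = psi3 * E2.
Proof.
apply: (mulIr E1_unit).
have h : (psi * E1) * W3 = E2 * (psi3 * E1) by rewrite -W3_E2 psi_E; ring.
by transitivity ((psi * E1) * W3); [ring | rewrite h; ring].
Qed.

(* The cubic theta functions of the Borweins: [aa = a(q)] and [c(q) = 3 q^(1/3) cc]. *)
Definition aa : fps := (A3 ^+ 3 + 4 * X * psi3 ^+ 3) / psi.
Definition cc : fps := E3 ^+ 3 / E1.

Lemma aa_psi : aa * psi = A3 ^+ 3 + 4 * X * psi3 ^+ 3.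
Proof. by rewrite divrK // psi_unit. Qed.

Lemma cc_E1 : cc * E1 = E3 ^+ 3.
Proof. by rewrite divrK // E1_unit. Qed.

Lemma cc_psi : cc * psi = A3 ^+ 2 * psi3.
Proof.
apply: (mulIr E1_unit).
apply: (mulIr E1_unit).
apply: (mulIr E6_unit).
apply: (mulIr E6_unit).
apply: (mulIr E3_unit).
have h : (cc * E1) * (psi * E1) * E6 ^+ 2 * E3
  = (A3 * E1 * E6) ^+ 2 * (psi3 * E3).
  by rewrite cc_E1 psi_E A3_E psi3_E; ring.
by transitivity ((cc * E1) * (psi * E1) * E6 ^+ 2 * E3); [ring | rewrite h; ring].
Qed.

Lemma psi_sub2_cc : psi * sub 2 cc = A3 * psi3 ^+ 2.
Proof.
have hc : sub 2 cc * E2 = E6 ^+ 3.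
  by rewrite /E2 -rmorphM cc_E1 rmorphXn /= sub2E3.
apply: (mulIr E1_unit).
apply: (mulIr E2_unit).
apply: (mulIr E6_unit).
apply: (mulIr E3_unit).
apply: (mulIr E3_unit).
have h : (psi * E1) * (sub 2 cc * E2) * E6 * E3 ^+ 2
  = (A3 * E1 * E6) * (psi3 * E3) ^+ 2 * E2.
  by rewrite psi_E hc A3_E psi3_E; ring.
by transitivity ((psi * E1) * (sub 2 cc * E2) * E6 * E3 ^+ 2); [ring | rewrite h; ring].
Qed.

(** The right side is the [q^(3n)]-part of [E1 ^+ 3 = phi ^+ 2 * psi], as computed from the
    dissections of [phi] and [psi]. *)
Lemma E1_aa : E1 * aa = phi3 ^+ 2 * A3 + 4 * X * W3 ^+ 2 * psi3.
Proof.
apply: (mulIr psi_unit).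
have h : E1 * (aa * psi) = (psi * phi3) * phi3 * A3 + 4 * X * (psi * W3) * W3 * psi3.
  rewrite aa_psi psi_phi3 psi_W3.
  rewrite (_ : E2 * A3 * phi3 = phi3 * E2 * A3); last by ring.
  rewrite (_ : 4 * X * (psi3 * E2) * W3 = 4 * X * psi3 * (W3 * E2)); last by ring.
  by rewrite phi3_E2 W3_E2; ring.
by transitivity (E1 * (aa * psi)); [ring | rewrite h; ring].
Qed.

Lemma E1_cc : E1 * cc = phi3 ^+ 2 * psi3.
Proof.
apply: (mulIr E6_unit).
apply: (mulIr E6_unit).
apply: (mulIr E3_unit).
have h : (cc * E1) * E6 ^+ 2 * E3
  = (phi3 * E6) ^+ 2 * (psi3 * E3).
  by rewrite cc_E1 phi3_E psi3_E; ring.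
by transitivity ((cc * E1) * E6 ^+ 2 * E3); [ring | rewrite h; ring].
Qed.

(** * Three-dissections and their components *)

Definition dis3 (f g h : fps) : fps := sub 3 f + X * sub 3 g + X ^+ 2 * sub 3 h.
Definition comp3 (r : nat) (f : fps) : fps := Fps (fun n => f (3 * n + r)%N).

Lemma sub3_coef r (f : fps) n : (r < 3)%N -> sub 3 f (3 * n + r)%N = if r == 0%N then f n else 0.
Proof.
move=> r3; rewrite /sub /= mulnC dvdn_addr ?dvdn_mull //.
by case: r r3 => [|[|[|]]] //= _; rewrite addn0 mulnK.
Qed.

Lemma sub3_coef0 (f : fps) n : sub 3 f (3 * n)%N = f n.
Proof. by have := sub3_coef 0 f n isT; rewrite addn0. Qed.

Lemma sub3_coef1 (f : fps) n : sub 3 f (3 * n).+1 = 0.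
Proof. by have := sub3_coef 1 f n isT; rewrite addn1. Qed.

Lemma sub3_coef2 (f : fps) n : sub 3 f (3 * n).+2 = 0.
Proof. by have := sub3_coef 2 f n isT; rewrite addn2. Qed.

Lemma comp3_dis3 f g h : (comp3 0 (dis3 f g h) = f) * (comp3 1 (dis3 f g h) = g)
  * (comp3 2 (dis3 f g h) = h).
Proof.
have E r n : comp3 r (dis3 f g h) n = sub 3 f (3 * n + r)%N
  + (if (1 <= 3 * n + r)%N then sub 3 g (3 * n + r - 1)%N else 0)
  + (if (2 <= 3 * n + r)%N then sub 3 h (3 * n + r - 2)%N else 0).
  by rewrite -!fcoefXnM expr1.
split; [split|]; apply: fpsP => n; rewrite E.
- rewrite addn0 sub3_coef0; case: n => [|n]; first by rewrite !addr0.
  have -> : (3 * n.+1 - 1 = (3 * n).+2)%N by lia.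
  have -> : (3 * n.+1 - 2 = (3 * n).+1)%N by lia.
  by rewrite sub3_coef1 sub3_coef2 !if_same !addr0.
- rewrite addn1 subn1 sub3_coef0 sub3_coef1 add0r; case: n => [|n]; first by rewrite addr0.
  have -> : ((3 * n.+1).+1 - 2 = (3 * n).+2)%N by lia.
  by rewrite sub3_coef2; case: (1 < _)%N; rewrite addr0.
by rewrite addn2 subn1 subn2 sub3_coef0 sub3_coef1 sub3_coef2; case: (0 < _)%N; rewrite !add0r.
Qed.

Lemma dis3_comp3 f : dis3 (comp3 0 f) (comp3 1 f) (comp3 2 f) = f.
Proof.
apply: fpsP => n; have [m [r [r3 ->]]] : exists m r, (r < 3)%N /\ n = (3 * m + r)%N.
  by exists (n %/ 3)%N, (n %% 3)%N; rewrite ltn_mod mulnC -divn_eq.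
suff h : comp3 r (dis3 (comp3 0 f) (comp3 1 f) (comp3 2 f)) = comp3 r f.
  by have := congr1 (coef^~ m) h; rewrite /comp3.
by case: r r3 => [|[|[|]]] // _; rewrite comp3_dis3.
Qed.

(** Triples multiply like polynomials of degree at most 2 in a cube root of [X]. *)
Lemma dis3M f g h f' g' h' : dis3 f g h * dis3 f' g' h' =
  dis3 (f * f' + X * (g * h' + h * g')) (f * g' + g * f' + X * (h * h'))
       (f * h' + g * g' + h * f').
Proof. rewrite /dis3 !(rmorphD, rmorphM) /= !sub_X; ring. Qed.

Lemma dis3Z c f g h : sub 3 c * dis3 f g h = dis3 (c * f) (c * g) (c * h).
Proof. rewrite /dis3 !rmorphM /=; ring. Qed.

(** Doubling exponents exchanges the residues 1 and 2; [q^4 = q q^3] leaves the factor [X]. *)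
Lemma sub2_dis3 f g h : sub 2 (dis3 f g h) = dis3 (sub 2 f) (X * sub 2 h) (sub 2 g).
Proof.
rewrite /dis3 !(rmorphD, rmorphM) /= ?rmorphXn /= !sub_X !subK.
by rewrite -[(2 * 3)%N]/6%N -[(3 * 2)%N]/6%N; ring.
Qed.

Lemma psi_dis3 : psi = dis3 A3 psi3 0.
Proof. by rewrite {1}psi_split3 /dis3 rmorph0 mulr0 addr0. Qed.

Lemma phi_dis3 : phi = dis3 phi3 (- 2 * W3) 0.
Proof. rewrite {1}phi_split3 /dis3 rmorph0 rmorphM rmorphN rmorph_nat; ring. Qed.

(* Comparing the [q^(3n)]-parts of [(q^2;q^2)^3], computed from [phi psi^2] and from
   [phi^2 psi] after [q -> q^2]. *)
Lemma sub2_E1_aa : E2 * sub 2 aa = phi3 * A3 ^+ 2 - 2 * X * W3 * psi3 ^+ 2.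
Proof.
have hAW := A3_W3.
rewrite /E2 -rmorphM E1_aa.
have h1 : E1 ^+ 3 = dis3 (phi3 ^+ 2 * A3 + 4 * X * W3 ^+ 2 * psi3)
    (phi3 ^+ 2 * psi3 - 4 * phi3 * (A3 * W3)) (-4 * phi3 * W3 * psi3 + 4 * (A3 * W3) * W3).
  rewrite -phi2_psi psi_dis3 phi_dis3 expr2 !dis3M; congr dis3; ring.
have h2 : E2 ^+ 3 = dis3 (phi3 * A3 ^+ 2 - 2 * X * W3 * psi3 ^+ 2)
    (2 * phi3 * psi3 * A3 - 2 * A3 * (A3 * W3)) (phi3 * psi3 ^+ 2 - 4 * (A3 * W3) * psi3).
  rewrite -phi_psi2 psi_dis3 phi_dis3 expr2 !dis3M; congr dis3; ring.
move: h2; rewrite [E2 in E2 ^+ 3]/E2 -rmorphXn /= h1 sub2_dis3 => /(congr1 (comp3 0)).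
by rewrite !comp3_dis3.
Qed.

Lemma sub2_aa_psi : sub 2 aa * psi = A3 ^+ 3 - 2 * X * psi3 ^+ 3.
Proof.
apply: (mulIr E2_unit).
have h : E2 * sub 2 aa * psi = (psi * phi3) * A3 ^+ 2 - 2 * X * (psi * W3) * psi3 ^+ 2.
  by rewrite sub2_E1_aa; ring.
by transitivity (E2 * sub 2 aa * psi); [ring | rewrite h psi_phi3 psi_W3; ring].
Qed.

(* The norm of [Z[[q]]] over [Z[[q^3]]], i.e. [f(q) f(wq) f(w^2 q)] with [w^3 = 1]. *)
Definition norm3 (f : fps) : fps :=
  comp3 0 f ^+ 3 + X * comp3 1 f ^+ 3 + X ^+ 2 * comp3 2 f ^+ 3
  - 3 * X * comp3 0 f * comp3 1 f * comp3 2 f.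

Lemma norm3_dis3 f g h : norm3 (dis3 f g h) =
  f ^+ 3 + X * g ^+ 3 + X ^+ 2 * h ^+ 3 - 3 * X * f * g * h.
Proof. by rewrite /norm3 !comp3_dis3. Qed.

Lemma norm3_1 : norm3 1 = 1.
Proof.
have -> : 1 = dis3 1 0 0 by rewrite /dis3 rmorph1 rmorph0; ring.
by rewrite norm3_dis3 /dis3 rmorph1 rmorph0; ring.
Qed.

Lemma norm3M f g : norm3 (f * g) = norm3 f * norm3 g.
Proof.
rewrite -(dis3_comp3 f) -(dis3_comp3 g) dis3M !norm3_dis3; ring.
Qed.

Lemma norm3_sub2 f : norm3 (sub 2 f) = sub 2 (norm3 f).
Proof.
rewrite -(dis3_comp3 f) sub2_dis3 !norm3_dis3.
rewrite !(rmorphB, rmorphD, rmorphM, rmorphXn, rmorph_nat) /= !sub_X; ring.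
Qed.

(** The three conjugates of [1 - q^n] are equal if 3 divides [n], and otherwise have product
    [1 - q^(3n)]; [norm3] renames [q^3] to [q]. *)
Lemma norm3_1BXn n :
  norm3 (1 - X ^+ n) = if (3 %| n)%N then (1 - X ^+ (n %/ 3)) ^+ 3 else 1 - X ^+ n.
Proof.
rewrite {1 4}(divn_eq n 3); have := ltn_pmod n (isT : (0 < 3)%N).
rewrite /dvdn; set m := (n %/ 3)%N; case: (n %% 3)%N => [|[|[|]]] //= _.
- have -> : 1 - X ^+ (m * 3 + 0) = dis3 (1 - X ^+ m) 0 0.
    by rewrite /dis3 !rmorph0 sub_1BXn addn0 mulnC; ring.
  by rewrite norm3_dis3; ring.
- have e : 1 - X ^+ (m * 3 + 1) = dis3 1 (- X ^+ m) 0.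
    by rewrite /dis3 rmorph1 rmorph0 rmorphN /= sub_Xn mulnC exprD; ring.
  by rewrite {1}e norm3_dis3 exprD exprM; ring.
- have e : 1 - X ^+ (m * 3 + 2) = dis3 1 0 (- X ^+ m).
    by rewrite /dis3 rmorph1 rmorph0 rmorphN /= sub_Xn mulnC exprD; ring.
  by rewrite {1}e norm3_dis3 exprD exprM; ring.
Qed.

Lemma eqm_norm3 n f g : eqm (3 * n) f g -> eqm n (norm3 f) (norm3 g).
Proof.
move=> h; have hc r : (r < 3)%N -> eqm n (comp3 r f) (comp3 r g).
  by move=> r3 i li /=; apply: h; lia.
have := (hc 0%N isT, hc 1%N isT, hc 2%N isT) => -[[h0 h1] h2].
rewrite /norm3; apply: eqmD.
  by do 2?apply: eqmD; do ?apply: eqmM; rewrite // ?exprS; do ?apply: eqmM; apply: eqmX.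
by apply: eqmN; do ?apply: eqmM.
Qed.

Lemma norm3_E1 : norm3 E1 * E3 = E1 ^+ 4.
Proof.
have h1 : multipliable (fun j => 1 - X ^+ j.+1) by apply: multipliable_1BXn.
have h3 : multipliable (fun j => 1 - X ^+ (3 * j.+1)) by apply: multipliable_1BXn => i; lia.
apply: eqmP => n.
have hE m : (n <= m)%N -> eqm n E1 (\prod_(j < m) (1 - X ^+ j.+1)) by apply: iprod_eqm.
rewrite /E3 sub_E1.
apply: eqm_trans (eqmM _ _ _ _ _ (eqm_norm3 _ _ _ (iprod_eqm _ _ (3 * n) h1 _))
                                (iprod_eqm _ _ n h3 _)) _ => //.
rewrite exprSr; apply: eqm_sym.
apply: eqm_trans (eqmM _ _ _ _ _ (eqmX _ _ _ 3 (hE n _)) (hE (3 * n)%N _)) _ => //; first by lia.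
(* Both sides contain each [1 - q^j] with [j <= 3n] once and, for [j <= n], three further times. *)
suff -> : norm3 (\prod_(j < 3 * n) (1 - X ^+ j.+1)) * \prod_(j < n) (1 - X ^+ (3 * j.+1)) =
   (\prod_(j < n) (1 - X ^+ j.+1)) ^+ 3 * \prod_(j < 3 * n) (1 - X ^+ j.+1) by [].
elim: n {hE} => [|n IH].
  by rewrite muln0 !big_ord0 norm3_1; ring.
have hp (F : nat -> fps) : \prod_(j < 3 * n.+1) F j =
    \prod_(j < 3 * n) F j * F (3 * n)%N * F (3 * n).+1 * F (3 * n).+2.
  by rewrite mulnS addnC !addnS addn0 !big_ord_recr.
rewrite (hp (fun j => 1 - X ^+ j.+1)) !big_ord_recr /= !norm3M !norm3_1BXn.
rewrite (_ : 3 %| (3 * n).+1 = false)%N; last by lia.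
rewrite (_ : 3 %| (3 * n).+2 = false)%N; last by lia.
rewrite (_ : 3 %| (3 * n).+3)%N; last by lia.
rewrite (_ : (3 * n).+3 %/ 3 = n.+1)%N; last by lia.
rewrite (_ : 3 * n.+1 = (3 * n).+3)%N; last by lia.
set a := \prod_(j < 3 * n) _ in IH *; set b := \prod_(j < n) _ in IH *.
set c := \prod_(j < n) _ in IH *.
transitivity (norm3 a * b * (1 - X ^+ n.+1) ^+ 3
  * ((1 - X ^+ (3 * n).+1) * (1 - X ^+ (3 * n).+2) * (1 - X ^+ (3 * n).+3))); first by ring.
by rewrite IH; ring.
Qed.

(** Norms are taken in [psi * E1 = E2 ^+ 2]; that of [psi] is read off its 3-dissection, those of
    [E1] and [E2] come from [norm3_E1]. *)
Lemma norm3_psi : (A3 ^+ 3 + X * psi3 ^+ 3) * psi3 = psi ^+ 4.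
Proof.
have hN : norm3 psi = A3 ^+ 3 + X * psi3 ^+ 3 by rewrite psi_dis3 norm3_dis3; ring.
have h2 : norm3 E2 * E6 = E2 ^+ 4.
  by rewrite norm3_sub2 -sub2E3 -rmorphM norm3_E1 rmorphXn.
have h : norm3 psi * norm3 E1 = norm3 E2 * norm3 E2 by rewrite -!norm3M psi_E.
rewrite -hN; apply: (mulIr E3_unit).
have u4 : E1 ^+ 4 \is a GRing.unit by rewrite unitrX // E1_unit.
apply: (mulIr u4).
have h1 := norm3_E1; have hp := psi_E; have h3 := psi3_E.
transitivity (norm3 psi * norm3 E1 * E6 ^+ 2 * E3).
  by rewrite -h3 -h1; ring.
by rewrite h (_ : psi ^+ 4 * E3 * E1 ^+ 4 = (psi * E1) ^+ 4 * E3); [rewrite hp; ring: h2 | ring].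
Qed.

Lemma aa_split3 : aa = dis3 aa (6 * cc) 0.
Proof.
have ha := aa_psi; have hn := norm3_psi.
have hP : psi = sub 3 A3 + X * sub 3 psi3 by rewrite {1}psi_split3.
have hn3 : (sub 3 A3 ^+ 3 + X ^+ 3 * sub 3 psi3 ^+ 3) * sub 3 psi3 = psi3 ^+ 4.
  by rewrite -(rmorphXn (sub 3) 4 psi) -norm3_psi !(rmorphM, rmorphD, rmorphXn) /= sub_X.
have ha3 : sub 3 aa * psi3 = sub 3 A3 ^+ 3 + 4 * X ^+ 3 * sub 3 psi3 ^+ 3.
  by rewrite -rmorphM ha !(rmorphM, rmorphD, rmorphXn, rmorph_nat) /= sub_X.
have hc3 : sub 3 cc * psi3 = sub 3 A3 ^+ 2 * sub 3 psi3.
  by rewrite -rmorphM cc_psi rmorphM rmorphXn.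
apply: (mulIr psi3_unit); apply: (mulIr psi_unit).
(* The common value of both sides times [psi3 * psi]: on the left by [aa_psi] and [norm3_psi], on
   the right by writing everything in [sub 3 A3] and [sub 3 psi3]. *)
transitivity (psi ^+ 4 + 3 * X * psi3 ^+ 4).
  by rewrite mulrAC ha -hn; ring.
rewrite /dis3 rmorph0 (rmorphM _ 6 cc) rmorph_nat /= -hn3.
transitivity (psi * (sub 3 aa * psi3) + 6 * X * psi * (sub 3 cc * psi3)); last by ring.
by rewrite ha3 hc3 hP; ring.
Qed.

(** * Dissections of the eta quotient and of the related products *)

Definition eta_quot : fps := E1 ^+ 2 * E2 ^+ 2 / E3.

(** [E3 * eta_quot = (phi * psi) ^+ 2], whose components (the middle one after multiplication by
    [A3]) match up to multiples of [phi3 * psi3 - A3 * W3 = 0]. *)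
Lemma eta_quot_split3 : eta_quot = dis3 (A3 * aa) (- 2 * psi3 * sub 2 aa) (- 3 * psi3 * cc).
Proof.
have hAW := A3_W3.
apply: (mulrI E3_unit); rewrite mulrCA divrr ?E3_unit // mulr1 {1}/E3 dis3Z.
rewrite -exprMn -phi_psi psi_dis3 phi_dis3 expr2 !dis3M; symmetry; congr dis3.
- transitivity (A3 * (E1 * aa)); first by ring.
  rewrite E1_aa; apply: subr0_eq.
  transitivity (4 * X * W3 * psi3 * (phi3 * psi3 - A3 * W3)); first by ring.
  by rewrite hAW subrr mulr0.
- apply: (mulIr A3_unit).
  transitivity (- 2 * psi3 * (E1 * A3) * sub 2 aa); first by ring.
  rewrite -phi3_E2; transitivity (- 2 * psi3 * phi3 * (E2 * sub 2 aa)); first by ring.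
  rewrite sub2_E1_aa; apply: subr0_eq.
  transitivity ((4 * X * W3 * psi3 ^+ 2 - 4 * phi3 * A3 ^+ 2) * (phi3 * psi3 - A3 * W3)).
    by ring.
  by rewrite hAW subrr mulr0.
- transitivity (- 3 * psi3 * (E1 * cc)); first by ring.
  rewrite E1_cc; apply: subr0_eq.
  transitivity (- 4 * (phi3 * psi3 - A3 * W3) ^+ 2); first by ring.
  by rewrite hAW subrr expr2 !mulr0.
Qed.

(** Components 0 and 2 are 1 and -2 times those of [eta_quot], so signs there reduce to positivity
    of [psi * aa]. *)
Lemma psi_aa_split3 : psi * aa = dis3 (A3 * aa) (6 * A3 * cc + psi3 * aa) (6 * psi3 * cc).
Proof. rewrite psi_dis3 {1}aa_split3 dis3M; congr dis3; ring. Qed.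

Lemma sub2_aa_split3 : sub 2 aa = dis3 (sub 2 aa) 0 (6 * sub 2 cc).
Proof. by rewrite {1}aa_split3 sub2_dis3 rmorph0 mulr0 (rmorphM _ 6 cc) rmorph_nat. Qed.

Lemma psi_sub2_aa_split3 : psi * sub 2 aa =
  dis3 (A3 * sub 2 aa + 6 * X * psi3 * sub 2 cc) (psi3 * sub 2 aa) (6 * A3 * sub 2 cc).
Proof. rewrite {1}psi_dis3 {1}sub2_aa_split3 dis3M; congr dis3; ring. Qed.

Lemma psi3_sub2_aa_split3 : psi3 * sub 2 aa =
  dis3 (psi * sub 2 aa) 0 (6 * (A3 * psi3 ^+ 2)).
Proof.
rewrite -psi_sub2_cc {1}sub2_aa_split3 /psi3 dis3Z mulr0; congr dis3; ring.
Qed.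

Lemma psi_cube_split3 : psi ^+ 3 =
  dis3 (A3 ^+ 3 + X * psi3 ^+ 3) (3 * A3 ^+ 2 * psi3) (3 * A3 * psi3 ^+ 2).
Proof. rewrite !exprS expr0 mulr1 {1 2 3}psi_dis3 !dis3M; congr dis3; ring. Qed.

(** * Three triangular numbers *)

Lemma X_const : X 0%N = 0. Proof. by []. Qed.

Lemma X2_const : (X ^+ 2) 0%N = 0. Proof. by rewrite fcoefXn. Qed.

Lemma unit_1BXn n : 1 - X ^+ n.+1 \is a GRing.unit.
Proof. by apply: unit_fps; rewrite coefBE coef1E fcoefXn subr0. Qed.

Lemma unit_1DXn n : 1 + X ^+ n.+1 \is a GRing.unit.
Proof. by apply: unit_fps; rewrite coefDE coef1E fcoefXn addr0. Qed.

Lemma fpsV1 (f : fps) : f 0%N = 1 -> f^-1 0%N = 1.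
Proof.
move=> f0; have := congr1 (coef^~ 0%N) (divrr (unit_fps _ f0)).
by rewrite coefM0 f0 mul1r.
Qed.

(* [po n = (q; q^2)_n] and [ve n = 1 / (q^2; q^2)_n]. *)
Definition po (n : nat) : fps := \prod_(j < n) (1 - X ^+ (2 * j).+1).
Definition ve (n : nat) : fps := (qfact (X ^+ 2) n)^-1.

Lemma poS n : po n.+1 = po n * (1 - X ^+ (2 * n).+1).
Proof. by rewrite /po big_ord_recr. Qed.

Lemma veS n : (1 - X ^+ (2 * n.+1)) * ve n.+1 = ve n.
Proof. by rewrite /ve -(qfactV _ n X2_const) -exprM. Qed.

Lemma ve0 : ve 0 = 1. Proof. by rewrite /ve /qfact big_ord0 invr1. Qed.

Lemma O1_unit : O1 \is a GRing.unit.
Proof. by apply/unit_fps/fps_iprod1 => i; rewrite coefBE coef1E fcoefXn subr0. Qed.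

Lemma psi_O1 : psi * O1 = E2.
Proof. by apply: (mulIr E2_unit); rewrite -mulrA -E1_O1 psi_E. Qed.

Lemma po_eqm n m : (n <= m)%N -> eqm n (po m) O1.
Proof.
move=> nm; apply: eqm_sym; apply: (iprod_eqm (fun j => 1 - X ^+ (2 * j).+1)) => //.
by apply: multipliable_1BXn => i; lia.
Qed.

Lemma ve_eqm n m : (n <= m)%N -> eqm n (ve m) E2^-1.
Proof.
move=> nm; apply: eqmV; first exact/qfact_1/X2_const.
  by rewrite sub0 E1_const.
apply: eqm_le (leqnSn n) _; apply: eqm_trans (qfact_eqm _ _ _ X2_const nm) _.
rewrite /E2 sub_E1 (eq_iprod _ (fun j => 1 - X ^+ (2 * j.+1))) // => j.
by rewrite exprM.
Qed.

Lemma qfact_X_double n : qfact X (2 * n) * ve n = po n.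
Proof.
elim: n => [|n IH]; first by rewrite muln0 ve0 /qfact /po !big_ord0 mulr1.
have -> : (2 * n.+1 = (2 * n).+2)%N by lia.
rewrite !qfactS poS -IH -(veS n); have -> : (2 * n.+1 = (2 * n).+2)%N by lia.
by ring.
Qed.

(* The Rogers-Szego identity [sum_k [n, k]_(q^2) q^k = (-q; q)_n] divided by [(q^2; q^2)_n]. *)
Lemma rogers_szego n : qconv (X ^+ 2) n (fun k => X ^+ k) = (qfact X n)^-1.
Proof.
pose h n := qconv (X ^+ 2) n (fun k => X ^+ k).
have hX m : qconv (X ^+ 2) m (fun i => X ^+ i.+1) = X * h m.
  by rewrite /h -qconvZ; apply: eq_qconv => i _; rewrite exprS.
have h0 : h 0%N = 1.
  by rewrite /h /qconv big_ord1 /= /qfact !big_ord0 invr1 !mulr1.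
have hQ m : qconv (X ^+ 2) m.+1 (fun i => (X ^+ 2) ^+ i * X ^+ i) = h m.+1 - X * h m.
  rewrite -hX -(qconv_low _ m (fun i => X ^+ i) X2_const).
  have -> (a b c : fps) : a = b - c <-> b = a + c.
    by split=> [->|->]; rewrite ?subrK ?addrK.
  rewrite /h -qconvD; apply: eq_qconv => i _; ring.
(* A second-order recurrence, from which [key] extracts the first-order one by induction. *)
have hS m : (1 - X ^+ (2 * m.+2)) * h m.+2 = (1 + X) * h m.+1 - X * h m.
  rewrite exprM [h m.+2]/h qconvS_low ?X2_const // hX hQ; ring.
have key m : (1 - X ^+ m.+1) * h m.+1 = h m.
  elim: m => [|m IH].
    have u := unit_1DXn 0; rewrite expr1 in u *; apply: (mulrI u).
    transitivity ((1 - (X ^+ 2) ^+ 1) * h 1%N); first by ring.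
    rewrite [h 1%N]/h qconvS_low ?X2_const // hX h0 /qconv big_ord1 /= /qfact !big_ord0.
    by rewrite invr1 !expr0; ring.
  apply: (mulrI (unit_1DXn m.+1)).
  transitivity ((1 - X ^+ (2 * m.+2)) * h m.+2); first by rewrite mulnC exprM; ring.
  by rewrite hS -IH !exprS; ring.
rewrite -[LHS]/(h n); elim: n => [|n IH]; first by rewrite h0 /qfact big_ord0 invr1.
by apply: (mulrI (unit_1BXn n)); rewrite key IH qfactV ?X_const.
Qed.

(** A case of the q-binomial theorem: for [f(z) = sum_n po n * ve n * z^n], the equation
    [(1 - z) f(z) = (1 - z q) f(z q^2)] is iterated from [z = q], and [f(q^(2m+1))] tends to 1. *)
Lemma psi_po_ve : psi = isum (fun n => po n * ve n * X ^+ n).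
Proof.
pose F m n : fps := po n * ve n * X ^+ ((2 * m).+1 * n).
have hF m : summable (F m) by move=> i; rewrite /F mulrC; apply: eqmXn0; nia.
pose f m := isum (F m).
have rec m : (1 - X ^+ (2 * m).+1) * f m = (1 - X ^+ (2 * m).+2) * f m.+1.
  have : f m - f m.+1 = X ^+ (2 * m).+1 * (f m - X * f m.+1).
    have hB : summable (fun n => F m n + -1 * F m.+1 n).
      by apply: summableD => //; apply: summableM.
    have -> : f m - f m.+1 = isum (fun n => F m n + -1 * F m.+1 n).
      by rewrite isumD isumM // mulN1r.
    rewrite isum_recl // [F m 0%N]/F [F m.+1 0%N]/F !muln0 mulN1r subrr add0r.
    have -> : f m - X * f m.+1 = isum (fun n => F m n + (- X) * F m.+1 n).
      by rewrite isumD isumM // mulNr.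
    rewrite -isumM; last by apply: summableD => //; apply: summableM.
    apply: eq_isum => n; rewrite /F poS -(veS n).
    have -> : ((2 * m.+1).+1 * n.+1 = (2 * m).+1 * n + (2 * m).+1 + 2 * n.+1)%N by lia.
    have -> : ((2 * m.+1).+1 * n = (2 * m).+1 * n + 2 * n)%N by lia.
    have -> : ((2 * m).+1 * n.+1 = (2 * m).+1 * n + (2 * m).+1)%N by lia.
    have -> : (2 * n.+1 = (2 * n).+2)%N by lia.
    move: ((2 * m).+1 * n)%N (2 * m).+1 (2 * n)%N => a b c.
    by rewrite ![X ^+ c.+1]exprS ![X ^+ c.+2]exprS !exprD ![X ^+ c.+2]exprS ![X ^+ c.+1]exprS; ring.
  move=> h; apply: subr0_eq; rewrite [X ^+ (2 * m).+2]exprSr.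
  transitivity (f m - f m.+1 - X ^+ (2 * m).+1 * (f m - X * f m.+1)); first by ring.
  by rewrite h subrr.
have prodE m : po m * f 0%N = qfact (X ^+ 2) m * f m.
  elim: m => [|m IH]; first by rewrite /po /qfact !big_ord0.
  rewrite poS mulrAC IH qfactS -exprM.
  transitivity (qfact (X ^+ 2) m * ((1 - X ^+ (2 * m).+1) * f m)); first by ring.
  rewrite rec.
  have -> : (2 * m.+1 = (2 * m).+2)%N by lia.
  by rewrite mulrA.
have lim m : eqm m (f m) 1.
  rewrite /f isum_recl // {1}/F muln0 mulr1 ve0 /po big_ord0 mulr1 -[X in eqm _ _ X]addr0.
  apply: eqmD => //; apply: eqm_trans (isum_eqm _ m m _ _) _ => //.
    by apply: summable_comp (hF m).
  elim/big_ind: _ => // [x y hx hy|i _]; first by rewrite -(addr0 0); apply: eqmD.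
  by rewrite /F mulrC; apply: eqmXn0; nia.
have e0 : isum (fun n => po n * ve n * X ^+ n) = f 0%N.
  by apply: eq_isum => n; rewrite /F muln0 mul1n.
rewrite e0; apply: (mulIr O1_unit); rewrite psi_O1; apply: eqmP => n.
rewrite mulrC; apply: eqm_sym.
apply: eqm_trans (eqmM _ _ _ _ _ (eqm_sym _ _ _ (po_eqm _ _ (leqnn n))) (eqm_refl _ _)) _.
rewrite prodE -[X in eqm _ _ X]mulr1; apply: eqmM => //.
have := eqmV _ _ _ _ _ (ve_eqm _ _ (leqnn n)); rewrite /ve !invrK; apply.
  by apply: fpsV1; exact/qfact_1/X2_const.
by apply: fpsV1; rewrite sub0 E1_const.
Qed.

Lemma eqm_sum0 n I (r : seq I) (Q : pred I) (F : I -> fps) :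
  (forall i, Q i -> eqm n (F i) 0) -> eqm n (\sum_(i <- r | Q i) F i) 0.
Proof.
move=> h; elim/big_ind: _ => // x y hx hy.
by rewrite -(addr0 0); apply: eqmD.
Qed.

Lemma ve_telescope n : \sum_(i < n.+1) X ^+ (2 * i) * ve i = ve n.
Proof.
elim: n => [|n IH]; first by rewrite big_ord1 muln0 mul1r.
by rewrite big_ord_recr /= IH -(veS n); ring.
Qed.

Definition gauss_term (m M : nat) : fps :=
  X ^+ (2 * M) * (po (M + m) ^+ 2 * ve M * ve (M + (2 * m).+1)).

Lemma summable_gauss m : summable (gauss_term m).
Proof. by apply: summableXn => i; lia. Qed.

(* The [q]-Zeilberger certificate of the recurrence [gauss_sumS]. *)
Definition gauss_cert (m M : nat) : fps :=
  let a := X ^+ (2 * m).+1 in let y := X ^+ (2 * M) in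
  (- a * (2 - a - a * X ^+ 2) + a ^+ 2 * (1 - a ^+ 2 * X ^+ 2) * y)
  * y * po (M + m) ^+ 2 * ((1 - y) * ve M) * ve (M + (2 * m).+2).

Lemma gauss_step m M :
  (1 - X ^+ (2 * m.+1).+1) ^+ 2 * gauss_term m.+1 M
    - (1 - X ^+ (2 * m).+1) ^+ 2 * gauss_term m M
  = gauss_cert m M.+1 - gauss_cert m M.
Proof.
rewrite /gauss_term /gauss_cert.
have -> : (M + m.+1 = (M + m).+1)%N by lia.
have -> : (M.+1 + m = (M + m).+1)%N by lia.
have -> : (M + (2 * m.+1).+1 = (M + (2 * m).+2).+1)%N by lia.
have -> : (M.+1 + (2 * m).+2 = (M + (2 * m).+2).+1)%N by lia.
(* The factor [(1 - y) * ve M] of the certificate at [M.+1] collapses to [ve M], and the other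
   inverse factorials become multiples of a single one. A polynomial identity in [X ^+ a] and
   [X ^+ b] remains. *)
rewrite poS (veS M) -[ve (M + (2 * m).+1)]veS -[(M + (2 * m).+1).+1]addnS.
rewrite -[ve (M + (2 * m).+2)]veS.
have -> : (2 * (M + (2 * m).+2) = 2 * (2 * m).+1 + 2 + 2 * M)%N by lia.
have -> : (2 * (M + (2 * m).+2).+1 = 2 * (2 * m).+1 + 4 + 2 * M)%N by lia.
have -> : ((2 * (M + m)).+1 = (2 * m).+1 + 2 * M)%N by lia.
have -> : ((2 * m.+1).+1 = (2 * m).+1 + 2)%N by lia.
have -> : (2 * M.+1 = 2 * M + 2)%N by lia.
move: (2 * m).+1 (2 * M)%N => a b.
rewrite (mulnC 2 a) !exprD !exprM; ring.
Qed.

Definition gauss_sum (m : nat) : fps := isum (gauss_term m).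

(** Summing [gauss_step] over [M] telescopes to 0: the certificate has the factor [1 - y], zero at
    [M = 0], and the factor [y = q^(2M)], which tends to 0. *)
Lemma gauss_sumS m :
  (1 - X ^+ (2 * m.+1).+1) ^+ 2 * gauss_sum m.+1 = (1 - X ^+ (2 * m).+1) ^+ 2 * gauss_sum m.
Proof.
have h1 := summable_gauss m; have h2 := summable_gauss m.+1.
set c1 := (X in X * gauss_sum m.+1); set c0 := (X in _ = X * _).
apply: subr0_eq.
have -> : c1 * gauss_sum m.+1 - c0 * gauss_sum m
    = isum (fun M => c1 * gauss_term m.+1 M + (- c0) * gauss_term m M).
  by rewrite isumD !isumM // mulNr.
apply: isumP => [|n]; first by apply: summableD; apply: summableM.
exists n => //; rewrite (eq_bigr (fun i : 'I_n => gauss_cert m i.+1 - gauss_cert m i)); last first.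
  by move=> i _; rewrite -gauss_step mulNr.
have -> : \sum_(i < n) (gauss_cert m i.+1 - gauss_cert m i) = gauss_cert m n - gauss_cert m 0.
  elim: n => [|n IH]; first by rewrite big_ord0 subrr.
  by rewrite big_ord_recr /= IH; ring.
have -> : gauss_cert m 0 = 0 by rewrite /gauss_cert muln0 expr0 subrr mul0r mulr0 mul0r.
rewrite subr0 /gauss_cert /= -!mulrA mulrCA; apply: eqmXn0; lia.
Qed.

(* A case of the [q]-Gauss sum: by [gauss_sumS] the left side does not depend on [m], so
   it equals its limit as [m] tends to infinity. *)
Lemma gauss_sumE m : psi ^+ 2 * ((1 - X ^+ (2 * m).+1) ^+ 2 * gauss_sum m) = 1.
Proof.
have cst k : (1 - X ^+ (2 * k).+1) ^+ 2 * gauss_sum k = (1 - X ^+ 1) ^+ 2 * gauss_sum 0.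
  by elim: k => // k IH; rewrite gauss_sumS.
(* Term [i] tends to [X ^+ (2 * i) * ve i] times [O1 ^+ 2 / E2], and [ve_telescope] sums these. *)
have lim k : eqm k ((1 - X ^+ (2 * k).+1) ^+ 2 * gauss_sum k) (O1 ^+ 2 * E2^-1 * E2^-1).
  rewrite -[X in eqm _ _ X]mul1r; apply: eqmM.
    rewrite -[X in eqm _ _ X](expr1n _ 2); apply: eqmX.
    by rewrite -[X in eqm _ _ X]subr0; apply: eqmD => //; apply: eqmN; rewrite -[X ^+ _]mulr1;
      apply: eqmXn0; lia.
  apply: eqm_trans (isum_eqm _ k k.+1 (summable_gauss k) _) _ => //.
  apply: eqm_trans (_ : eqm k _ (O1 ^+ 2 * E2^-1 * ve k)) _.
    rewrite -ve_telescope mulr_sumr; apply: eqm_sum => i _; rewrite /gauss_term.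
    rewrite [X in eqm _ _ X](_ : _ = X ^+ (2 * i) * (O1 ^+ 2 * ve i * E2^-1)); last by ring.
    apply: eqmM => //; apply: eqmM; last by apply: ve_eqm; lia.
    by apply: eqmM => //; apply: eqmX; apply: po_eqm; lia.
  by apply: eqmM => //; apply: ve_eqm.
have -> : (1 - X ^+ (2 * m).+1) ^+ 2 * gauss_sum m = O1 ^+ 2 * E2^-1 * E2^-1.
  by apply: eqmP => k; rewrite cst -(cst k).
rewrite -psi_O1; have u : psi * O1 \is a GRing.unit by rewrite psi_O1 E2_unit.
transitivity ((psi * O1) / (psi * O1) * ((psi * O1) / (psi * O1))); last by rewrite divrr // mulr1.
by rewrite expr2; ring.
Qed.

(** In the double sum of [psi_rho], this collects the terms at distance [m] from the centre [k = N],
    up to a power of [X]. *)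
Definition rho (m : nat) : fps :=
  isum (fun M => X ^+ (2 * M) * (po (M + m) ^+ 2 * ve M * ve (M + 2 * m))).

Lemma summable_rho m :
  summable (fun M => X ^+ (2 * M) * (po (M + m) ^+ 2 * ve M * ve (M + 2 * m))).
Proof. by apply: summableXn => i; lia. Qed.

(** From [1 - q^(2(M+2m+1)) = (1 - q^(4m+2)) + q^(4m+2) (1 - q^(2M))]; the last factor kills the
    term [M = 0], and shifting [M] yields [rho m.+1]. *)
Lemma rho_rec m :
  rho m = X ^+ (4 * m + 4) * rho m.+1 + (1 - X ^+ (4 * m + 2)) * gauss_sum m.
Proof.
pose G M := X ^+ (2 * M) * (po (M + m) ^+ 2 * ((1 - X ^+ (2 * M)) * ve M) * ve (M + (2 * m).+1)).
have hG : summable G by apply: summableXn => i; lia.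
have hr := summable_rho m.+1.
have hs := summable_gauss m.
have -> : X ^+ (4 * m + 4) * rho m.+1 = isum (fun M => X ^+ (4 * m + 2) * G M).
  rewrite isumM // (isum_recl G) // {1}/G muln0 expr0 subrr mul0r mulr0 mul0r mulr0 add0r.
  have -> : (4 * m + 4 = 4 * m + 2 + 2)%N by lia.
  rewrite [X ^+ (4 * m + 2 + 2)]exprD -mulrA; congr (_ * _).
  rewrite -(isumM _ _ hr); apply: eq_isum => M.
  rewrite /G veS; have -> : (M + m.+1 = M.+1 + m)%N by lia.
  have -> : (M + 2 * m.+1 = M.+1 + (2 * m).+1)%N by lia.
  have -> : (2 * M.+1 = 2 + 2 * M)%N by lia.
  by rewrite exprD; ring.
rewrite -(isumM _ _ hs) -isumD; apply: eq_isum => M; rewrite /G /gauss_term.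
have -> : (M + (2 * m).+1 = (M + 2 * m).+1)%N by lia.
rewrite -[ve (M + 2 * m)]veS.
have -> : (2 * (M + 2 * m).+1 = 4 * m + 2 + 2 * M)%N by lia.
move: (4 * m + 2)%N => a; rewrite !exprD; ring.
Qed.

(** * Positivity of the coefficients of [psi ^+ 3] *)

Definition nonneg (f : fps) := forall n, 0 <= f n.

Lemma geom_nonneg k (g : fps) : (1 - X ^+ k.+1) * g = 1 + X ^+ k.+1 -> nonneg g.
Proof.
move=> h n; elim/ltn_ind: n => n IH.
have := congr1 (coef^~ n) h; rewrite mulrBl mul1r coefBE fcoefXnM coefDE coef1E fcoefXn.
move/(canRL (subrK _)) => ->; rewrite addr_ge0 ?addr_ge0 ?ler0n //.
by case: ifP => // kn; apply: IH; lia.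
Qed.

Lemma geom1_pos (g : fps) : (1 - X ^+ 1) * g = 1 + X ^+ 1 -> forall n, 0 < g n.
Proof.
move=> h n; elim: n => [|n IH]; have := congr1 (coef^~ _) h.
  move/(_ 0%N); rewrite mulrBl mul1r coefBE fcoefXnM coefDE coef1E fcoefXn /= => /eqP.
  by rewrite subr0 addr0 => /eqP ->.
move/(_ n.+1); rewrite mulrBl mul1r coefBE fcoefXnM coefDE coef1E fcoefXn /= subn1.
by move/(canRL (subrK _)) => ->; rewrite add0r ltr_wpDl // ler0n.
Qed.

(** By [gauss_sumE], multiplying [rho_rec] by [psi ^+ 2] turns its last term into
    [(1 + q^(2m+1)) / (1 - q^(2m+1))]. *)
Lemma psi2_rho_rec m : exists2 g, (1 - X ^+ (2 * m).+1) * g = 1 + X ^+ (2 * m).+1 &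
  psi ^+ 2 * rho m = X ^+ (4 * m + 4) * (psi ^+ 2 * rho m.+1) + g.
Proof.
exists (psi ^+ 2 * ((1 - X ^+ (4 * m + 2)) * gauss_sum m)); last by rewrite rho_rec; ring.
have -> : (4 * m + 2 = (2 * m).+1 * 2)%N by lia.
rewrite exprM; have := gauss_sumE m; set x := X ^+ _ => h.
transitivity ((1 + x) * (psi ^+ 2 * ((1 - x) ^+ 2 * gauss_sum m))); first by ring.
by rewrite h mulr1.
Qed.

Lemma psi2_rho_nonneg m : nonneg (psi ^+ 2 * rho m).
Proof.
move=> n; elim/ltn_ind: n m => n IH m.
have [g hg ->] := psi2_rho_rec m; rewrite coefDE fcoefXnM addr_ge0 ?(geom_nonneg _ _ hg) //.
by case: ifP => // mn; apply: IH; lia.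
Qed.

Lemma psi2_rho0_pos n : 0 < (psi ^+ 2 * rho 0) n.
Proof.
have [g hg ->] := psi2_rho_rec 0; rewrite coefDE ltr_wpDl ?(geom1_pos _ hg) //.
by rewrite fcoefXnM; case: ifP => // _; apply: psi2_rho_nonneg.
Qed.

(** Interchange of summations with [N = M + n + 1]; the hypothesis keeps each coefficient a finite
    sum. *)
Lemma isum_triangle (T : nat -> nat -> fps) :
  (forall N n, (n < N)%N -> eqm N (T N n) 0) ->
  isum (fun N => \sum_(n < N) T N n) = isum (fun n => isum (fun M => T (M + n.+1)%N n)).
Proof.
move=> hT.
have hs n : summable (fun M => T (M + n.+1)%N n).
  by move=> M; apply: eqm_le (hT _ _ _); lia.
have hs2 : summable (fun n => isum (fun M => T (M + n.+1)%N n)).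
  move=> n i li; rewrite /isum /= big1 // => M _.
  by apply: (hT (M + n.+1)%N); lia.
apply: isumP => [N|k]; first by apply: eqm_sum0 => n _; apply: hT.
exists k => //; apply: eqm_sym; apply: eqm_trans (isum_eqm _ k k hs2 _) _ => //.
have -> : \sum_(N < k) \sum_(n < N) T N n = \sum_(n < k) \sum_(M < k - n.+1) T (M + n.+1)%N n.
  elim: k => [|k IH]; first by rewrite !big_ord0.
  rewrite big_ord_recr [RHS]big_ord_recr /= subnn [in RHS]big_ord0 addr0 IH -big_split /=.
  apply: eq_bigr => -[n /= nk] _; have -> : (k.+1 - n.+1 = (k - n.+1).+1)%N by lia.
  by rewrite big_ord_recr /= subnK.
apply: eqm_sum => -[n /= nk] _.
apply: eqm_trans (isum_eqm _ k k (hs n) _) _ => //.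
have -> : \sum_(M < k) T (M + n.+1)%N n = \sum_(M < (k - n.+1) + n.+1) T (M + n.+1)%N n.
  by rewrite subnK.
rewrite big_split_ord /= -[X in eqm _ _ X]addr0; apply: eqmD => //.
by apply: eqm_sum0 => -[j /= lj] _; apply: eqm_le (hT _ _ _); lia.
Qed.

(** [po N * ve N = po N ^+ 2 / (q;q)_(2N)], and [rogers_szego] expands the denominator into a sum
    over [k <= 2N], split into [k = N], [k = N + n + 1] and [k = N - n - 1]. *)
Lemma psi_rho : psi = rho 0 + isum (fun n => X ^+ (3 * n.+1) * rho n.+1)
                            + isum (fun n => X ^+ n.+1 * rho n.+1).
Proof.
pose c N k := po N ^+ 2 * X ^+ (N + k) * ve k * ve (2 * N - k).
have hc N k j : (j <= N + k)%N -> eqm j (c N k) 0.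
  move=> jk; have -> : c N k = X ^+ (N + k) * (po N ^+ 2 * ve k * ve (2 * N - k)).
    by rewrite /c; ring.
  exact: eqmXn0.
pose up N n := c N (N + n.+1)%N; pose dn N n := c N (N - n.+1)%N.
have h N : po N * ve N * X ^+ N = c N N + (\sum_(n < N) up N n + \sum_(n < N) dn N n).
  have -> : po N * ve N * X ^+ N = \sum_(k < (2 * N).+1) c N k.
    have -> : po N * ve N = po N ^+ 2 * (qfact X (2 * N))^-1.
      have u : qfact X (2 * N) \is a GRing.unit by apply: qfact_unit; exact: X_const.
      apply: (mulIr u); rewrite divrK //.
      by transitivity (po N * (qfact X (2 * N) * ve N)); [ring | rewrite qfact_X_double].
    rewrite -rogers_szego /qconv mulr_sumr mulr_suml; apply: eq_bigr => k _.
    by rewrite /c /ve exprD; ring.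
  have -> : ((2 * N).+1 = N + N.+1)%N by lia.
  rewrite big_split_ord /= big_ord_recl /= addn0 (reindex_inj rev_ord_inj) /=.
  rewrite addrC -addrA; congr (_ + (_ + _)).
have tup N n : (n < N)%N -> eqm N (up N n) 0.
  by move=> nN; apply: hc; lia.
have tdn N n : (n < N)%N -> eqm N (dn N n) 0.
  by move=> nN; apply: hc; lia.
rewrite psi_po_ve (eq_isum _ _ h) !isumD addrA !isum_triangle //.
congr (_ + _ + _); last 2 first.
- apply: eq_isum => n; rewrite -isumM; last exact: summable_rho.
  apply: eq_isum => M; rewrite /up /c.
  have -> : (2 * (M + n.+1) - (M + n.+1 + n.+1) = M)%N by lia.
  have -> : (M + n.+1 + (M + n.+1 + n.+1) = 3 * n.+1 + 2 * M)%N by lia.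
  have -> : (M + n.+1 + n.+1 = M + 2 * n.+1)%N by lia.
  by rewrite exprD; ring.
- apply: eq_isum => n; rewrite -isumM; last exact: summable_rho.
  apply: eq_isum => M; rewrite /dn /c addnK.
  have -> : (2 * (M + n.+1) - M = M + 2 * n.+1)%N by lia.
  have -> : (M + n.+1 + M = n.+1 + 2 * M)%N by lia.
  by rewrite exprD; ring.
apply: eq_isum => M; rewrite /c !addn0.
have -> : (2 * M - M = M)%N by lia.
by rewrite addnn -mul2n; ring.
Qed.

(* Gauss' theorem on three triangular numbers, since [psi = sum_k q^(k(k+1)/2)]. *)
Theorem psi_cube_pos n : 0 < (psi ^+ 3) n.
Proof.
have hs (f : nat -> nat) : (forall i, (i <= f i)%N) -> summable (fun n => X ^+ f n * rho n.+1).
  by move=> hf; apply: summableXn.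
have tail (f : nat -> nat) : (forall i, (i <= f i)%N) ->
    0 <= (psi ^+ 2 * isum (fun n => X ^+ f n * rho n.+1)) n.
  move=> hf; rewrite -(isumM _ _ (hs f hf)) /isum /= sumr_ge0 // => i _.
  rewrite -[X in 0 <= X]/((psi ^+ 2 * (X ^+ f i * rho i.+1)) n) mulrCA fcoefXnM.
  by case: ifP => // _; apply: psi2_rho_nonneg.
(* Only one factor [psi] is expanded; strictness comes from the [rho 0] term. *)
rewrite exprSr {2}psi_rho !mulrDr !coefDE -addrA ltr_wpDr ?psi2_rho0_pos //.
by rewrite addr_ge0 // tail // => i; lia.
Qed.

(** * Coefficients of the eta quotient *)

Definition fps_of_poly (p : {poly int}) : fps := Fps (fun n => p`_n).

Fact fps_of_polyB : zmod_morphism fps_of_poly.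
Proof. by move=> p q; apply: fpsP => n; rewrite coefBE /= coefB. Qed.

Fact fps_of_polyM : monoid_morphism fps_of_poly.
Proof.
split=> [|p q]; apply: fpsP => n; first by rewrite /= coef1.
by rewrite coefME /= coefM.
Qed.

HB.instance Definition _ := GRing.isZmodMorphism.Build _ _ fps_of_poly fps_of_polyB.
HB.instance Definition _ := GRing.isMonoidMorphism.Build _ _ fps_of_poly fps_of_polyM.

Lemma fps_of_polyX : fps_of_poly 'X = X.
Proof. by apply: fpsP => n; rewrite /= coefX. Qed.

Lemma geom_sum (x : fps) N : (1 - x) * \sum_(k < N) x ^+ k = 1 - x ^+ N.
Proof. by rewrite -[RHS]opprB subrX1 -mulNr opprB. Qed.

(** Multiplying by [E3] avoids inverses: each truncated geometric series times its [1 - q^(3j)] is 1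
    modulo [X ^+ N]. *)
Lemma C122_eta_quot n : C122 n = eta_quot n.
Proof.
pose G N j : fps := \sum_(k < N.+1) (X ^+ (3 * j.+1)) ^+ k.
have hT N : fps_of_poly (eta_trunc N) =
    \prod_(j < N) ((1 - X ^+ j.+1) ^+ 2 * (1 - X ^+ (2 * j.+1)) ^+ 2 * G N j).
  rewrite rmorph_prod; apply: eq_bigr => j _.
  rewrite !rmorphM !rmorphB !rmorph1 !rmorphXn /= fps_of_polyX; congr (_ * _).
  rewrite rmorph_sum; apply: eq_bigr => k _.
  by rewrite rmorphXn /= fps_of_polyX exprM.
suff h N : eqm N (fps_of_poly (eta_trunc N)) eta_quot by rewrite -(h n.+1).
have e3 : eqm N (\prod_(j < N) (1 - X ^+ (3 * j.+1))) E3.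
  rewrite /E3 sub_E1; apply: eqm_sym; apply: iprod_eqm => //.
  by apply: multipliable_1BXn => i; lia.
have e2 : eqm N (\prod_(j < N) (1 - X ^+ (2 * j.+1))) E2.
  rewrite /E2 sub_E1; apply: eqm_sym; apply: iprod_eqm => //.
  by apply: multipliable_1BXn => i; lia.
have e1 : eqm N (\prod_(j < N) (1 - X ^+ j.+1)) E1.
  by apply: eqm_sym; apply: iprod_eqm => //; apply: multipliable_1BXn.
suff h : eqm N (fps_of_poly (eta_trunc N) * E3) (E1 ^+ 2 * E2 ^+ 2).
  rewrite -[fps_of_poly _](mulrK E3_unit); exact: eqmM.
apply: eqm_trans (eqmM _ _ _ _ _ (eqm_refl _ _) (eqm_sym _ _ _ e3)) _.
rewrite hT -big_split /=.
apply: eqm_trans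
  (_ : eqm N _ (\prod_(j < N) ((1 - X ^+ j.+1) ^+ 2 * (1 - X ^+ (2 * j.+1)) ^+ 2))) _.
  apply: eqm_prod => j _; rewrite -[X in eqm _ _ X]mulr1 -[X in eqm _ X _]mulrA; apply: eqmM => //.
  rewrite mulrC /G geom_sum -!exprM -[X in eqm _ _ X]subr0; apply: eqmD => //; apply: eqmN.
  by rewrite -[X ^+ _]mulr1; apply: eqmXn0; nia.
by rewrite big_split /= !prodrXl; apply: eqmM; apply: eqmX.
Qed.

Lemma coef_dis3 f g h n : (dis3 f g h (3 * n)%N = f n) * (dis3 f g h (3 * n).+1 = g n)
  * (dis3 f g h (3 * n).+2 = h n).
Proof.
have [[h0 h1] h2] := comp3_dis3 f g h.
have c r : comp3 r (dis3 f g h) n = dis3 f g h (3 * n + r)%N by [].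
by split; [split|]; [rewrite -{2}h0 c addn0 | rewrite -{2}h1 c addn1 | rewrite -{2}h2 c addn2].
Qed.

(** [A3 ^+ 3 + X * psi3 ^+ 3] is the [q^(3n)]-part of [psi ^+ 3], hence positive by Gauss' theorem;
    the remaining [3 X psi3^3] is nonnegative. *)
Lemma psi_aa_pos n : 0 < (psi * aa) n.
Proof.
have -> : psi * aa = A3 ^+ 3 + X * psi3 ^+ 3 + (X * psi3 ^+ 3 + X * psi3 ^+ 3 + X * psi3 ^+ 3).
  by rewrite mulrC aa_psi; ring.
have hX k : 0 <= (X * psi3 ^+ 3) k.
  case: k => [|k]; first by rewrite coefM0 X_const mul0r.
  rewrite fcoefXM -(rmorphXn (sub 3) 3 psi) /sub /=; case: ifP => // _.
  exact: ltW (psi_cube_pos _).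
rewrite coefDE ltr_wpDr //; first by rewrite !coefDE !addr_ge0.
by have := psi_cube_pos (3 * n); rewrite psi_cube_split3 coef_dis3.
Qed.

Lemma C122_0mod3 k : 0 < C122 (3 * k).
Proof.
have := psi_aa_pos (3 * k).
by rewrite C122_eta_quot eta_quot_split3 psi_aa_split3 !coef_dis3.
Qed.

Lemma C122_2mod3 k : C122 (3 * k).+2 < 0.
Proof.
have := psi_aa_pos (3 * k).+2.
rewrite C122_eta_quot eta_quot_split3 psi_aa_split3 !coef_dis3.
(* Numerals become sums of ones, so that coefficients expand linearly for [lia]. *)
have -> : 6 * psi3 * cc = (1 + 1 + 1 + 1 + 1 + 1) * (psi3 * cc) by ring.
have -> : - 3 * psi3 * cc = - (1 + 1 + 1) * (psi3 * cc) by ring.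
rewrite !mulNr !mulrDl mul1r !(coefDE, coefNE); lia.
Qed.

Lemma C122_1mod3 k : C122 (3 * k).+1 = - ((psi3 * sub 2 aa) k + (psi3 * sub 2 aa) k).
Proof.
rewrite C122_eta_quot eta_quot_split3 coef_dis3 -coefDE -coefNE; congr (coef _ k); ring.
Qed.

Lemma C122_4mod9 j : C122 (9 * j + 4) = 0.
Proof.
have -> : (9 * j + 4 = (3 * (3 * j).+1).+1)%N by lia.
by rewrite C122_1mod3 psi3_sub2_aa_split3 coef_dis3 coef0E addr0 oppr0.
Qed.

Lemma C122_7mod9 j : C122 (9 * j + 7) < 0.
Proof.
have -> : (9 * j + 7 = (3 * (3 * j).+2).+1)%N by lia.
have := psi_cube_pos (3 * j).+2; rewrite psi_cube_split3 coef_dis3.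
rewrite C122_1mod3 psi3_sub2_aa_split3 coef_dis3.
have -> : 6 * (A3 * psi3 ^+ 2) = 3 * A3 * psi3 ^+ 2 + 3 * A3 * psi3 ^+ 2 by ring.
rewrite coefDE; lia.
Qed.

Lemma C122_1mod9 j : C122 (9 * j + 1) = - ((psi * sub 2 aa) j + (psi * sub 2 aa) j).
Proof.
have -> : (9 * j + 1 = (3 * (3 * j)).+1)%N by lia.
by rewrite C122_1mod3 psi3_sub2_aa_split3 coef_dis3.
Qed.

(** Component 1 of [psi * sub 2 aa] is [psi3 * sub 2 aa], the series behind [C122_1mod3]. *)
Lemma C122_1mod9_rec k : C122 (9 * (3 * k).+1 + 1) = C122 (3 * k).+1.
Proof. by rewrite C122_1mod9 C122_1mod3 psi_sub2_aa_split3 coef_dis3. Qed.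

(** [psi * aa] and [psi * sub 2 aa] differ by [6 X psi3^3], which lives on exponents 1 mod 3. *)
Lemma C122_1mod9_neg j : (j %% 3 != 1)%N -> C122 (9 * j + 1) < 0.
Proof.
move=> j3; suff h : (psi * sub 2 aa) j = (psi * aa) j.
  by rewrite C122_1mod9 h; have := psi_aa_pos j; lia.
have -> : psi * sub 2 aa = psi * aa - 6 * (X * psi3 ^+ 3).
  by rewrite ![psi * _]mulrC sub2_aa_psi aa_psi; ring.
have -> : X * psi3 ^+ 3 = dis3 0 (psi ^+ 3) 0.
  by rewrite /dis3 !rmorph0 rmorphXn /=; rewrite -/psi3; ring.
have -> : 6 * dis3 0 (psi ^+ 3) 0 = dis3 0 (6 * psi ^+ 3) 0.
  by rewrite /dis3 !rmorph0 (rmorphM _ 6) rmorph_nat; ring.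
rewrite coefBE; apply/eqP; rewrite subr_eq addrC -subr_eq subrr eq_sym; apply/eqP.
rewrite (divn_eq j 3) mulnC; have := ltn_pmod j (isT : (0 < 3)%N); move: j3.
by case: (j %% 3)%N => [|[|[|]]] // _ _; rewrite ?addn0 ?addn2 coef_dis3.
Qed.

Theorem theorem1p7 (n a m : nat) :
  (8 * n + 1 = 3 ^ a * m)%N -> ~~ (3 %| m)%N ->
  [/\ (a = 0)%N -> Num.sg (C122 n) = legendre3 m,
      (a = 1)%N -> Num.sg (C122 n) = - ((legendre3 m + 1) %/ 2)%Z,
      (a = 2)%N -> Num.sg (C122 n) = -1
    & (3 <= a)%N -> Num.sg (C122 n) = Num.sg (C122 ((n - 1) %/ 9))].
Proof.
move=> hn h3; split=> ha.
(* Here [m = 8n + 1]: [n = 0] mod 3 gives [m = 1], and [n = 2] gives [m = 2] mod 3. *)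
- move: hn; rewrite ha expn0 mul1n => hm; rewrite /legendre3.
  have [k [hk|hk]] : exists k, n = (3 * k)%N \/ n = (3 * k).+2.
    by exists (n %/ 3)%N; lia.
  + rewrite hk gtr0_sg ?C122_0mod3 // ifT //; lia.
  + rewrite hk ltr0_sg ?C122_2mod3 // ifF ?ifT //; lia.
(* [n = 9k + 4] gives [m = 24k + 11] with symbol -1, and [n = 9k + 7] gives [m = 24k + 19] with
   symbol 1. *)
- move: hn; rewrite ha expn1 => hm; rewrite /legendre3.
  have [k [hk|hk]] : exists k, n = (9 * k + 4)%N \/ n = (9 * k + 7)%N.
    by exists (n %/ 9)%N; lia.
  + by rewrite hk C122_4mod9 sgr0 ifF ?ifT //; lia.
  + by rewrite hk ltr0_sg ?C122_7mod9 // ifT //; lia.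
(* With [n = 9j + 1] one gets [m = 8j + 1], so [3] not dividing [m] means that [j] is not 1 mod
   3. *)
- move: hn; rewrite ha -[(3 ^ 2)%N]/9%N => hm.
  have [j hj] : exists j, n = (9 * j + 1)%N by exists (n %/ 9)%N; lia.
  by rewrite hj ltr0_sg // C122_1mod9_neg //; lia.
(* Divisibility of [8n + 1] by 27 forces [n = 27k + 10]. *)
- move: hn; rewrite -(subnK ha) expnD -[(3 ^ 3)%N]/27%N.
  move: (3 ^ (a - 3))%N => b hm.
  have [k hk] : exists k, n = (9 * (3 * k).+1 + 1)%N.
    by exists (n %/ 27)%N; nia.
  have -> : ((n - 1) %/ 9 = (3 * k).+1)%N by lia.
  by rewrite hk C122_1mod9_rec.
Qed.
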